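(* For any $(a_n)_{n=1}^N\in\mathcal A_1$ (with $N\in\overline{\mathbb N}$) and any sequence $\{\mathcal P_n\}_{n=1}^N$ of pyramids, the direct sum $\sum_{n=1}^N\mathcal P_n^{a_n}$ is a pyramid.
   Context: An mm-space is a triple $(X,d_X,\mu_X)$ where $(X,d_X)$ is a complete separable metric space and $\mu_X$ is a Borel probability measure on it. Two mm-spaces are mm-isomorphic if there is an isometry $f:\operatorname{supp}\mu_X\to\operatorname{supp}\mu_Y$ with $f_*\mu_X=\mu_Y$; $\mathcal X$ denotes the set of mm-isomorphism classes of mm-spaces. For mm-spaces, $Y\prec X$ (Lipschitz order) means there is a 1-Lipschitz map $f:X\to Y$ with $f_*\mu_X=\mu_Y$. The box distance $\square(X,Y)$ is the infimum of $\max\{\operatorname{dis}(S),1-\pi(S)\}$ over all couplings $\pi$ of $\mu_X$ and $\mu_Y$ and all Borel $S\subset X\times Y$, where $\operatorname{dis}(S)=\sup\{|d_X(x,x')-d_Y(y,y')|:(x,y),(x',y')\in S\}$ and $\operatorname{dis}(\emptyset)=0$; it is a metric on $\mathcal X$ inducing the box topology. A pyramid is a nonempty subset $\mathcal P\subset\mathcal X$ that is closed in the box topology, satisfies ($Y\in\mathcal P$ and $X\prec Y$) $\Rightarrow X\in\mathcal P$, and is directed: for any $X,Y\in\mathcal P$ there is $Z\in\mathcal P$ with $X\prec Z$ and $Y\prec Z$. Let $\overline{\mathbb N}=\mathbb N\cup\{\infty\}$, and for $N\in\overline{\mathbb N}$ let $[N]=\{1,\dots,N\}$ if $N<\infty$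 and $[N]=\mathbb N$ if $N=\infty$. $\mathcal A_1$ is the set of all sequences $(a_n)_{n=1}^N$, $N\in\overline{\mathbb N}$, with $a_n\in(0,1]$ and $\sum_{n=1}^N a_n=1$. For $(a_n)_{n=1}^N\in\mathcal A_1$ and pyramids $\mathcal P_n$, $n\in[N]$, the direct sum $\sum_{n=1}^N\mathcal P_n^{a_n}$ is the set of all $X\in\mathcal X$ for which there exist mm-spaces $X_n\in\mathcal P_n$ and 1-Lipschitz maps $f_n:X_n\to X$, $n\in[N]$, such that $\mu_X=\sum_{n=1}^N a_n(f_n)_*\mu_{X_n}$. *)

(* Defs.v *)
From Stdlib Require Import Reals Lra.
Open Scope R_scope.

Section Metric.
Variable X : Type.
Variable d : X -> X -> R.

Definition is_metric : Prop :=
  (forall x y, 0 <= d x y) /\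
  (forall x y, d x y = 0 <-> x = y) /\
  (forall x y, d x y = d y x) /\
  (forall x y z, d x z <= d x y + d y z).

Definition complete_metric : Prop :=
  forall u : nat -> X,
    (forall e, 0 < e -> exists N, forall m n, (N <= m)%nat -> (N <= n)%nat -> d (u m) (u n) < e) ->
    exists x, forall e, 0 < e -> exists N, forall n, (N <= n)%nat -> d (u n) x < e.

(* separability: existence of a countable dense subset (X is nonempty here
   since it carries a probability measure) *)
Definition separable_metric : Prop :=
  exists s : nat -> X, forall x e, 0 < e -> exists n, d x (s n) < e.

Definition ball (x : X) (r : R) : X -> Prop := fun y => d x y < r.

Definition open_set (U : X -> Prop) : Prop :=
  forall x, U x -> exists r, 0 < r /\ forall y, d x y < r -> U y.

Definition sigma_algebra (F : (X -> Prop) -> Prop) : Prop :=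
  F (fun _ => False) /\
  (forall A, F A -> F (fun x => ~ A x)) /\
  (forall A : nat -> X -> Prop, (forall n, F (A n)) -> F (fun x => exists n, A n x)).

Definition borel (A : X -> Prop) : Prop :=
  forall F, sigma_algebra F -> (forall U, open_set U -> F U) -> F A.

(* Borel probability measure (its values on non-Borel sets are irrelevant) *)
Definition is_borel_prob (mu : (X -> Prop) -> R) : Prop :=
  (forall A, borel A -> 0 <= mu A) /\
  mu (fun _ => True) = 1 /\
  (forall A : nat -> X -> Prop,
     (forall n, borel (A n)) ->
     (forall m n x, m <> n -> A m x -> A n x -> False) ->
     infinite_sum (fun n => mu (A n)) (mu (fun x => exists n, A n x))).

Definition supp (mu : (X -> Prop) -> R) (x : X) : Prop :=
  forall r, 0 < r -> 0 < mu (ball x r).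

End Metric.

Arguments is_metric {X}.
Arguments complete_metric {X}.
Arguments separable_metric {X}.
Arguments ball {X}.
Arguments open_set {X}.
Arguments sigma_algebra {X}.
Arguments borel {X}.
Arguments is_borel_prob {X}.
Arguments supp {X}.

Record mmspace := MMSpace {
  mm_car :> Type;
  mm_d : mm_car -> mm_car -> R;
  mm_mu : (mm_car -> Prop) -> R;
  mm_is_metric : is_metric mm_d;
  mm_complete : complete_metric mm_d;
  mm_separable : separable_metric mm_d;
  mm_prob : is_borel_prob mm_d mm_mu }.
Arguments mm_d {m}.
Arguments mm_mu {m}.

Definition Borel (X : mmspace) (A : X -> Prop) : Prop := borel (@mm_d X) A.
Arguments Borel {X}.
Definition Supp (X : mmspace) : X -> Prop := supp (@mm_d X) (@mm_mu X).

Definition preim {A B : Type} (f : A -> B) (S : B -> Prop) : A -> Prop :=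
  fun a => S (f a).

(* mm-isomorphism: an isometry f : supp mu_X -> supp mu_Y (onto) with
   f_* mu_X = mu_Y.  f is given as a total map, only its restriction to
   supp mu_X matters. *)
Definition mm_iso (X Y : mmspace) : Prop :=
  exists f : X -> Y,
    (forall x, Supp X x -> Supp Y (f x)) /\
    (forall y, Supp Y y -> exists x, Supp X x /\ f x = y) /\
    (forall x x', Supp X x -> Supp X x' -> mm_d (f x) (f x') = mm_d x x') /\
    (forall B, Borel B -> mm_mu B = mm_mu (fun x => Supp X x /\ B (f x))).

Definition one_lipschitz {X Y : mmspace} (f : X -> Y) : Prop :=
  forall x x', mm_d (f x) (f x') <= mm_d x x'.

Definition lip_prec (Y X : mmspace) : Prop :=
  exists f : X -> Y, one_lipschitz f /\
    forall B, Borel B -> mm_mu B = mm_mu (preim f B).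

(* product metric (max) on X × Y; it induces the product topology *)
Definition prod_d (X Y : mmspace) (p q : X * Y) : R :=
  Rmax (mm_d (fst p) (fst q)) (mm_d (snd p) (snd q)).

Definition coupling (X Y : mmspace) (pi : (X * Y -> Prop) -> R) : Prop :=
  is_borel_prob (prod_d X Y) pi /\
  (forall A, Borel A -> pi (fun p => A (fst p)) = mm_mu A) /\
  (forall B, Borel B -> pi (fun p => B (snd p)) = mm_mu B).

Definition dis_le (X Y : mmspace) (S : X * Y -> Prop) (e : R) : Prop :=
  forall p q, S p -> S q ->
    Rabs (mm_d (fst p) (fst q) - mm_d (snd p) (snd q)) <= e.

(* box(X,Y) < e, i.e. the infimum of max{dis S, 1 - pi S} is < e *)
Definition box_lt (X Y : mmspace) (e : R) : Prop :=
  exists pi S e', coupling X Y pi /\ borel (prod_d X Y) S /\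
    e' < e /\ dis_le X Y S e' /\ 1 - pi S <= e'.

(* a subset of the space of mm-isomorphism classes *)
Definition iso_invariant (P : mmspace -> Prop) : Prop :=
  forall X Y, mm_iso X Y -> P X -> P Y.

Definition box_closed (P : mmspace -> Prop) : Prop :=
  forall X, (forall e, 0 < e -> exists Y, P Y /\ box_lt X Y e) -> P X.

Definition pyramid (P : mmspace -> Prop) : Prop :=
  iso_invariant P /\
  (exists X, P X) /\
  box_closed P /\
  (forall X Y, P Y -> lip_prec X Y -> P X) /\
  (forall X Y, P X -> P Y -> exists Z, P Z /\ lip_prec X Z /\ lip_prec Y Z).

(* N ∈ ℕ ∪ {∞}: [Some N] is N, [None] is ∞; [N] = {1..N} resp. ℕ = {1,2,...} *)
Definition in_range (N : option nat) (n : nat) : Prop :=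
  (1 <= n)%nat /\ match N with Some m => (n <= m)%nat | None => True end.

Fixpoint fsum (u : nat -> R) (N : nat) : R :=
  match N with O => 0 | S k => fsum u k + u (S k) end.

Definition sum_is (N : option nat) (u : nat -> R) (l : R) : Prop :=
  match N with
  | Some m => fsum u m = l
  | None => infinite_sum (fun k => u (S k)) l
  end.

Definition in_A1 (N : option nat) (a : nat -> R) : Prop :=
  (forall n, in_range N n -> 0 < a n <= 1) /\ sum_is N a 1.

(* direct sum  sum_{n=1}^N P_n^{a_n}  (as a set of mm-isomorphism classes) *)
Definition direct_sum (N : option nat) (a : nat -> R)
    (P : nat -> mmspace -> Prop) (X : mmspace) : Prop :=
  exists X' : mmspace, mm_iso X X' /\
  exists (Xs : nat -> mmspace) (f : forall n, Xs n -> X'),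
    (forall n, in_range N n -> P n (Xs n)) /\
    (forall n, in_range N n -> one_lipschitz (f n)) /\
    (forall B, Borel B ->
       sum_is N (fun n => a n * mm_mu (preim (f n) B)) (mm_mu B)).

(* Main.v *)
From HB Require Import structures.
From mathcomp Require all_boot all_order all_algebra all_classical.
From mathcomp Require reals constructive_ereal ereal topology normedtype sequences measure lebesgue_integral Rstruct.
From Stdlib Require Import Reals Lra Lia Cantor ClassicalEpsilon FunctionalExtensionality PropExtensionality.
Require Import Defs.
Open Scope R_scope.

(** An mm-space [X] lies in the direct sum iff its own measure decomposes as
    [mu = sum a_n nu_n] with [(X, nu_n)] in [P_n] ([splits]): push the measures of
    the [X_n] forward to [X].  In this form the direct sum is visibly closed under
    Lipschitz images, and two decomposed spaces [X], [Y] are dominated by [X * Y]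
    with the max metric and the sum of the images of common dominators [Z_n].

    For box-closedness let [Y_k -> X] with couplings [pi_k] and decompositions
    [nu_{k,n}] of [Y_k].  Multiplying [pi_k] by the density of [nu_{k,n}], averaged
    over small cells of [Y_k], and projecting to [X] yields decompositions
    [eta_{k,n}] of [mu_X].  Since [a_n eta_{k,n} <= mu_X], the limits of
    [eta_{k,n}(B)] along a nonprincipal ultrafilter, taken for every Borel set [B]
    separately, are again measures [eta_n], and they decompose [mu_X].  Finally
    [(X, eta_n)] and [(Y_k, nu_{k,n})] are close in the box distance: a transport
    plan between the cells of two fine finite partitions, realised by rescaled
    product measures, is an almost optimal coupling.  Hence [(X, eta_n)] is in
    [P_n]. *)

(** * Borel sets and finite measures *)

(** Since a pyramid is closed for the box distance only, [(X, eta_n)] has to be reached through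
    approximants, and all [n] must be treated along one sequence [Y_k]; an ultrafilter does this
    without diagonal subsequences or tightness. All quantitative control comes from [a_n > 0] and
    [a_n nu_n <= mu]: densities are at most [/ a_n], so a set that is small for [mu] is small for
    each summand. The loss depends on [n] alone and is harmless, because closeness is required for
    each [n] separately. Averaging over cells makes densities quotients of masses, so no
    Radon-Nikodym derivative occurs. Setwise limits give closeness on finitely many Borel sets at a
    time; hence the partition of [X] is fixed by [n] and the target accuracy before [k] is chosen,
    while that of [Y_k] is refined with [k]. Isomorphisms are controlled on supports alone, so the
    arguments vary the measure on a fixed space and cross isomorphisms only in passing between
    direct sums and splittings. *)

Lemma pred_ext {T : Type} (A B : T -> Prop) : (forall x, A x <-> B x) -> A = B.
Proof.
  intros H; apply functional_extensionality; intros x.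
  apply propositional_extensionality, H.
Qed.

Lemma choice_fun {A B : Type} (Q : A -> B -> Prop) :
  (forall x, exists y, Q x y) -> exists f, forall x, Q x (f x).
Proof.
  intros H; exists (fun x => proj1_sig (constructive_indefinite_description _ (H x))).
  intros x; exact (proj2_sig (constructive_indefinite_description _ (H x))).
Qed.

Section Borel.
Context {X : Type} (d : X -> X -> R).

Lemma borel_sigma : sigma_algebra (borel d).
Proof.
  split; [|split].
  - intros F [H0 _] _; exact H0.
  - intros A HA F HF HU; apply HF, HA; assumption.
  - intros A HA F HF HU; apply HF; intros n; apply HA; assumption.
Qed.

Lemma borel_open U : open_set d U -> borel d U.
Proof. intros HU F _ HF; apply HF, HU. Qed.

Lemma borel_False : borel d (fun _ => False).
Proof. apply borel_sigma. Qed.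

Lemma borel_not A : borel d A -> borel d (fun x => ~ A x).
Proof. apply borel_sigma. Qed.

Lemma borel_ex (A : nat -> X -> Prop) :
  (forall n, borel d (A n)) -> borel d (fun x => exists n, A n x).
Proof. apply borel_sigma. Qed.

Lemma borel_True : borel d (fun _ => True).
Proof.
  rewrite (pred_ext (fun _ => True) (fun _ : X => ~ False)) by tauto.
  apply borel_not, borel_False.
Qed.

Lemma borel_const (Q : Prop) : borel d (fun _ => Q).
Proof.
  destruct (classic Q) as [H|H].
  - rewrite (pred_ext (fun _ => Q) (fun _ : X => True)) by tauto. apply borel_True.
  - rewrite (pred_ext (fun _ => Q) (fun _ : X => False)) by tauto. apply borel_False.
Qed.

Lemma borel_or A B : borel d A -> borel d B -> borel d (fun x => A x \/ B x).
Proof.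
  intros HA HB.
  rewrite (pred_ext _ (fun x => exists n : nat, (match n with O => A | _ => B end) x)).
  - apply borel_ex; intros [|n]; assumption.
  - intros x; split.
    + intros [H|H]; [exists O|exists 1%nat]; exact H.
    + intros [[|n] H]; tauto.
Qed.

Lemma borel_and A B : borel d A -> borel d B -> borel d (fun x => A x /\ B x).
Proof.
  intros HA HB.
  rewrite (pred_ext _ (fun x => ~ (~ A x \/ ~ B x))).
  - apply borel_not, borel_or; apply borel_not; assumption.
  - intros x; split; [tauto|intros H; split; apply NNPP; tauto].
Qed.

End Borel.

Lemma borel_preim {X Y : Type} (d : X -> X -> R) (d' : Y -> Y -> R) (f : X -> Y) :
  (forall U, open_set d' U -> borel d (fun x => U (f x))) ->
  forall B, borel d' B -> borel d (fun x => B (f x)).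
Proof.
  intros Hf B HB; apply (HB (fun B => borel d (fun x => B (f x)))); [|exact Hf].
  split; [|split].
  - apply borel_False.
  - intros A; apply borel_not.
  - intros A; apply borel_ex.
Qed.

Lemma borel_preim_lipschitz {X Y : Type} (d : X -> X -> R) (d' : Y -> Y -> R) (f : X -> Y) :
  (forall x x', d' (f x) (f x') <= d x x') ->
  forall B, borel d' B -> borel d (fun x => B (f x)).
Proof.
  intros Hf; apply borel_preim; intros U HU; apply borel_open; intros x Hx.
  destruct (HU _ Hx) as [r [Hr H]]; exists r; split; [exact Hr|].
  intros y Hy; apply H; specialize (Hf x y); lra.
Qed.

Lemma small_inv (e : R) : 0 < e -> exists k : nat, / INR (S k) < e.
Proof.
  intros He; destruct (archimed_cor1 e He) as [n [Hn Hp]].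
  exists (pred n); replace (S (pred n)) with n by lia; exact Hn.
Qed.

Lemma inv_INR_pos k : 0 < / INR (S k).
Proof. apply Rinv_0_lt_compat, lt_0_INR; lia. Qed.

(** Separability enters here: it places the Borel sets of the max metric inside the product
    sigma-algebra, where the product measure lives. The rectangles are products of balls around
    points of the two dense sequences with a common radius [/ INR (S k)], the three indices being
    coded in one. *)
Lemma open_prod_countable (X Y : mmspace) (U : X * Y -> Prop) :
  open_set (prod_d X Y) U ->
  exists (A : nat -> X -> Prop) (B : nat -> Y -> Prop),
    (forall n, Borel (A n)) /\ (forall n, Borel (B n)) /\
    U = (fun p => exists n, A n (fst p) /\ B n (snd p)).
Proof.
  intros HU.
  destruct (mm_separable X) as [s Hs], (mm_separable Y) as [t Ht].
  destruct (mm_is_metric X) as [_ [_ [symX triX]]].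
  destruct (mm_is_metric Y) as [_ [_ [symY triY]]].
  assert (openball : forall (Z : mmspace) (z : Z) r, open_set (@mm_d Z) (fun y => mm_d z y < r)).
  { intros Z z r y Hy; exists (r - mm_d z y); split; [lra|].
    intros w Hw; destruct (mm_is_metric Z) as [_ [_ [_ tri]]].
    specialize (tri z y w); lra. }
  pose (i n := fst (of_nat n)). pose (j n := fst (of_nat (snd (of_nat n)))).
  pose (k n := snd (of_nat (snd (of_nat n)))).
  pose (rad n := / INR (S (k n))).
  (* [ok n] says that the n-th rectangle lies in [U]; put into the first factor below, it empties
     the rectangles that do not. *)
  pose (ok n := forall p : X * Y,
     mm_d (s (i n)) (fst p) < rad n -> mm_d (t (j n)) (snd p) < rad n -> U p).
  exists (fun n x => ok n /\ mm_d (s (i n)) x < rad n), (fun n y => mm_d (t (j n)) y < rad n).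
  split; [|split].
  - intros n; apply borel_and; [apply borel_const|apply borel_open, openball].
  - intros n; apply borel_open, openball.
  - apply pred_ext; intros [x y]; split.
    + intros Hxy; destruct (HU _ Hxy) as [r [Hr H]].
      destruct (small_inv (r/2)) as [m Hm]; [lra|].
      destruct (Hs x _ (inv_INR_pos m)) as [n1 H1], (Ht y _ (inv_INR_pos m)) as [n2 H2].
      exists (to_nat (n1, to_nat (n2, m))).
      unfold ok, rad, i, j, k; rewrite !cancel_of_to; cbn [fst snd].
      rewrite !cancel_of_to; cbn [fst snd].
      rewrite (symX x), (symY y) in *; repeat split; trivial.
      intros [x' y'] Hx Hy; apply H; unfold prod_d; cbn [fst snd] in *.
      pose proof (triX x (s n1) x'); pose proof (triY y (t n2) y').
      rewrite (symX x (s n1)) in *; rewrite (symY y (t n2)) in *.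
      apply Rmax_lub_lt; lra.
    + intros [n [[Hok H1] H2]]; exact (Hok (x, y) H1 H2).
Qed.

(** The least witness makes a countable cover disjoint: each point goes to the first set containing
    it. *)
Lemma first_index (Q : nat -> Prop) :
  (exists n, Q n) -> exists n, Q n /\ forall k, (k < n)%nat -> ~ Q k.
Proof.
  intros [n Hn]; revert Hn; induction n as [n IH] using (well_founded_induction Wf_nat.lt_wf).
  intros Hn; destruct (classic (exists k, (k < n)%nat /\ Q k)) as [[k [Hk HQ]]|H].
  - exact (IH k Hk HQ).
  - exists n; split; [exact Hn|]; intros k Hk HQ; apply H; exists k; tauto.
Qed.

Lemma borel_forall_lt {X : Type} (d : X -> X -> R) (A : nat -> X -> Prop) n :
  (forall k, borel d (A k)) -> borel d (fun x => forall k, (k < n)%nat -> A k x).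
Proof.
  intros HA.
  rewrite (pred_ext _ (fun x => ~ exists k, (k < n)%nat /\ ~ A k x)).
  - apply borel_not, borel_ex; intros k; apply borel_and; [apply borel_const|].
    apply borel_not, HA.
  - intros x; split; [firstorder|].
    intros H k Hk; apply NNPP; intros HN; apply H; exists k; tauto.
Qed.

(** * Charges and finite measures *)

Section Measures.
Context {X : Type} (d : X -> X -> R).

(** Transferred measures and setwise limits are first known to be finitely additive. Estimates on
    finite partitions work at this level; countable additivity is recovered for the limit by
    domination. *)
Definition charge (m : (X -> Prop) -> R) : Prop :=
  (forall A, borel d A -> 0 <= m A) /\
  (forall A B, borel d A -> borel d B -> (forall x, A x -> B x -> False) ->
     m (fun x => A x \/ B x) = m A + m B).

Definition finmeas (m : (X -> Prop) -> R) : Prop :=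
  (forall A, borel d A -> 0 <= m A) /\
  (forall A : nat -> X -> Prop,
     (forall n, borel d (A n)) ->
     (forall m n x, m <> n -> A m x -> A n x -> False) ->
     infinite_sum (fun n => m (A n)) (m (fun x => exists n, A n x))).

Lemma is_borel_probE m :
  is_borel_prob d m <-> finmeas m /\ m (fun _ => True) = 1.
Proof. unfold is_borel_prob, finmeas; tauto. Qed.

(** Consecutive partial sums of the constant series differ by [c], although both lie strictly within
    [c / 2] of the limit. *)
Lemma finmeas_False m : finmeas m -> m (fun _ => False) = 0.
Proof.
  intros [H0 H1]; specialize (H0 _ (borel_False d)).
  assert (H := H1 (fun _ _ => False) (fun _ => borel_False d) (fun _ _ _ _ h _ => h)).
  cbv beta in H; set (c := m (fun _ => False)) in *.
  destruct (Req_dec c 0) as [|Hc]; [assumption|exfalso].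
  destruct (H (c/2)) as [N HN]; [lra|].
  assert (H2 := HN N (le_n _)); assert (H3 := HN (S N) (le_S _ _ (le_n _))).
  unfold Rdist in *; cbn [sum_f_R0] in H3.
  apply Rabs_def2 in H2; apply Rabs_def2 in H3; lra.
Qed.

Lemma finmeas_charge m : finmeas m -> charge m.
Proof.
  intros Hm; split; [apply Hm|]; intros A B HA HB Hd.
  pose (C n := match n with O => A | 1%nat => B | _ => fun _ => False end).
  assert (H : infinite_sum (fun n => m (C n)) (m (fun x => exists n, C n x))).
  { apply Hm.
    - intros [|[|n]]; try assumption; apply borel_False.
    - intros [|[|i]] [|[|j]] x; cbn; try tauto; intros _ h1 h2; eapply Hd; eassumption. }
  replace (fun x => A x \/ B x) with (fun x => exists n, C n x).
  - apply (UL_sequence (sum_f_R0 (fun n => m (C n)))); [exact H|].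
    intros e He; exists 1%nat; intros n Hn.
    replace (sum_f_R0 (fun n => m (C n)) n) with (m A + m B).
    + unfold Rdist; rewrite Rminus_diag, Rabs_R0; exact He.
    + induction n as [|[|n] IH]; [lia|reflexivity|].
      cbn [sum_f_R0] in *; rewrite <- IH by lia.
      cbn [C]; rewrite finmeas_False by exact Hm; ring.
  - apply pred_ext; intros x; split.
    + intros [[|[|n]] H']; cbn in H'; tauto.
    + intros [h|h]; [exists O|exists 1%nat]; exact h.
Qed.

Lemma charge_False m : charge m -> m (fun _ => False) = 0.
Proof.
  intros [_ H]; specialize (H _ _ (borel_False d) (borel_False d) (fun _ h _ => h)).
  rewrite (pred_ext _ (fun _ : X => False)) in H by tauto; lra.
Qed.

Lemma charge_split m A B : charge m -> borel d A -> borel d B ->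
  m A = m (fun x => A x /\ B x) + m (fun x => A x /\ ~ B x).
Proof.
  intros [_ H] HA HB; rewrite <- H.
  - f_equal; apply pred_ext; intros x; tauto.
  - apply borel_and; assumption.
  - apply borel_and; [|apply borel_not]; assumption.
  - tauto.
Qed.

Lemma charge_mono m A B : charge m -> borel d A -> borel d B ->
  (forall x, A x -> B x) -> m A <= m B.
Proof.
  intros Hm HA HB H; rewrite (charge_split m B A Hm HB HA).
  rewrite (pred_ext (fun x => B x /\ A x) A) by (intros x; specialize (H x); tauto).
  enough (0 <= m (fun x => B x /\ ~ A x)) by lra.
  apply Hm, borel_and; [|apply borel_not]; assumption.
Qed.

Lemma charge_not m A : charge m -> borel d A ->
  m (fun x => ~ A x) = m (fun _ => True) - m A.
Proof.
  intros Hm HA; rewrite (charge_split m _ A Hm (borel_True d) HA).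
  rewrite (pred_ext (fun x => True /\ A x) A), (pred_ext (fun x => True /\ ~ A x) (fun x => ~ A x))
    by (intros; tauto); ring.
Qed.

Lemma charge_or m A B : charge m -> borel d A -> borel d B ->
  m (fun x => A x \/ B x) <= m A + m B.
Proof.
  intros Hm HA HB.
  rewrite (charge_split m (fun x => A x \/ B x) A) by (try apply borel_or; assumption).
  apply Rplus_le_compat; apply charge_mono; try assumption;
    repeat first [apply borel_and | apply borel_or | apply borel_not | assumption]; tauto.
Qed.

Lemma charge_partial_union m (A : nat -> X -> Prop) n :
  charge m -> (forall k, borel d (A k)) ->
  (forall i j x, i <> j -> A i x -> A j x -> False) ->
  m (fun x => exists k, (k <= n)%nat /\ A k x) = sum_f_R0 (fun k => m (A k)) n.
Proof.
  intros Hm HA Hd; induction n as [|n IH]; cbn [sum_f_R0].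
  - f_equal; apply pred_ext; intros x; split.
    + intros [k [Hk H]]; replace k with O in H by lia; exact H.
    + intros H; exists O; split; [lia|exact H].
  - rewrite <- IH, <- (proj2 Hm).
    + f_equal; apply pred_ext; intros x; split.
      * intros [k [Hk H]]; destruct (Nat.eq_dec k (S n)) as [->|]; [tauto|].
        left; exists k; split; [lia|exact H].
      * intros [[k [Hk H]]|H]; [exists k|exists (S n)]; split; trivial; lia.
    + apply borel_ex; intros k; apply borel_and; [apply borel_const|apply HA].
    + apply HA.
    + intros x [k [Hk H]] H'; apply (Hd k (S n) x); trivial; lia.
Qed.

(** Finite additivity identifies the error of a partial sum with the mass of the tail, so countable
    additivity means that tails tend to zero. *)
Lemma charge_tail m (A : nat -> X -> Prop) n :
  charge m -> (forall k, borel d (A k)) ->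
  (forall i j x, i <> j -> A i x -> A j x -> False) ->
  m (fun x => exists k, (n < k)%nat /\ A k x) =
  m (fun x => exists k, A k x) - sum_f_R0 (fun k => m (A k)) n.
Proof.
  intros Hm HA Hd; rewrite <- charge_partial_union by assumption.
  enough (m (fun x => exists k, A k x) =
    m (fun x => exists k, (k <= n)%nat /\ A k x) + m (fun x => exists k, (n < k)%nat /\ A k x)) by lra.
  rewrite <- (proj2 Hm).
  - f_equal; apply pred_ext; intros x; split.
    + intros [k H]; destruct (Compare_dec.le_lt_dec k n); [left|right]; exists k; tauto.
    + intros [[k H]|[k H]]; exists k; tauto.
  - apply borel_ex; intros k; apply borel_and; [apply borel_const|apply HA].
  - apply borel_ex; intros k; apply borel_and; [apply borel_const|apply HA].
  - intros x [i [Hi H]] [j [Hj H']]; apply (Hd i j x); trivial; lia.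
Qed.

Lemma finmeas_tail m (A : nat -> X -> Prop) :
  finmeas m -> (forall k, borel d (A k)) ->
  (forall i j x, i <> j -> A i x -> A j x -> False) ->
  Un_cv (fun n => m (fun x => exists k, (n < k)%nat /\ A k x)) 0.
Proof.
  intros Hm HA Hd e He; destruct (proj2 Hm A HA Hd e He) as [N HN].
  exists N; intros n Hn; specialize (HN n Hn).
  rewrite (charge_tail m A n (finmeas_charge _ Hm) HA Hd).
  unfold Rdist in *; rewrite Rminus_0_r, Rabs_minus_sym.
  exact HN.
Qed.

(* A charge that is approximately dominated by finite measures is itself
   countably additive: this turns both series and ultrafilter limits of measures
   into measures. *)
Lemma charge_dominated m : charge m ->
  (forall e, 0 < e -> exists mu c, finmeas mu /\ 0 <= c /\
     forall B, borel d B -> m B <= c * mu B + e) ->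
  finmeas m.
Proof.
  intros Hm Hdom; split; [apply Hm|]; intros A HA Hd e He.
  destruct (Hdom (e/2)) as [mu [c [Hmu [Hc H]]]]; [lra|].
  destruct (finmeas_tail mu A Hmu HA Hd (e / (2 * (c + 1)))) as [N HN].
  { apply Rdiv_lt_0_compat; lra. }
  exists N; intros n Hn; specialize (HN n Hn).
  assert (bT : borel d (fun x => exists k, (n < k)%nat /\ A k x)).
  { apply borel_ex; intros k; apply borel_and; [apply borel_const|apply HA]. }
  specialize (H _ bT); assert (H0 := proj1 Hm _ bT); assert (H1 := proj1 Hmu _ bT).
  rewrite (charge_tail m A n Hm HA Hd) in *.
  unfold Rdist in *; rewrite Rminus_0_r, Rabs_pos_eq in HN by exact H1.
  rewrite Rabs_minus_sym, Rabs_pos_eq by exact H0.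
  set (t := mu _) in *.
  assert (c * t <= (c + 1) * t) by nra.
  assert ((c + 1) * t < (c + 1) * (e / (2 * (c + 1)))) by (apply Rmult_lt_compat_l; lra).
  replace ((c + 1) * (e / (2 * (c + 1)))) with (e / 2) in * by (field; lra); lra.
Qed.

Lemma finmeas_scal m c : 0 <= c -> finmeas m -> finmeas (fun B => c * m B).
Proof.
  intros Hc Hm; assert (Cm := finmeas_charge _ Hm); apply charge_dominated.
  - split.
    + intros A HA; apply Rmult_le_pos; [exact Hc|apply Hm, HA].
    + intros A B HA HB Hd; rewrite (proj2 Cm) by assumption; ring.
  - intros e He; exists m, c; split; [exact Hm|split; [exact Hc|]]; intros; lra.
Qed.

Lemma finmeas_plus m m' : finmeas m -> finmeas m' ->
  finmeas (fun B => m B + m' B).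
Proof.
  intros [H0 H1] [H0' H1']; split.
  - intros A HA; specialize (H0 A HA); specialize (H0' A HA); lra.
  - intros A HA Hd e He.
    destruct (CV_plus _ _ _ _ (H1 A HA Hd) (H1' A HA Hd) e He) as [N HN].
    exists N; intros n Hn; rewrite sum_plus; apply HN, Hn.
Qed.

Lemma finmeas_sum (m : nat -> (X -> Prop) -> R) n :
  (forall k, (k <= n)%nat -> finmeas (m k)) ->
  finmeas (fun B => sum_f_R0 (fun k => m k B) n).
Proof.
  intros H; induction n as [|n IH]; cbn [sum_f_R0].
  - apply (H O), le_n.
  - apply (finmeas_plus (fun B => sum_f_R0 (fun k => m k B) n)).
    + apply IH; intros k Hk; apply H; lia.
    + apply H, le_n.
Qed.

Lemma finmeas_restrict m C : finmeas m -> borel d C ->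
  finmeas (fun B => m (fun x => B x /\ C x)).
Proof.
  intros Hm HC; assert (Cm := finmeas_charge _ Hm); apply charge_dominated.
  - split.
    + intros A HA; apply Hm, borel_and; assumption.
    + intros A B HA HB Hd; rewrite <- (proj2 Cm).
      * f_equal; apply pred_ext; tauto.
      * apply borel_and; assumption.
      * apply borel_and; assumption.
      * intros x [] []; eapply Hd; eassumption.
  - intros e He; exists m, 1; split; [exact Hm|split; [lra|]]; intros B HB.
    enough (m (fun x => B x /\ C x) <= m B) by lra.
    apply charge_mono; try assumption; [apply borel_and; assumption|tauto].
Qed.

Lemma finmeas_null_union m (A : nat -> X -> Prop) :
  finmeas m -> (forall n, borel d (A n)) -> (forall n, m (A n) <= 0) ->
  m (fun x => exists n, A n x) = 0.
Proof.
  intros Hm HA H0; assert (Cm := finmeas_charge _ Hm).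
  pose (B n x := A n x /\ forall k, (k < n)%nat -> ~ A k x).
  assert (bB : forall n, borel d (B n)).
  { intros n; apply borel_and; [apply HA|].
    apply (borel_forall_lt d (fun k x => ~ A k x)); intros k; apply borel_not, HA. }
  assert (zB : forall n, m (B n) = 0).
  { intros n; apply Rle_antisym; [|apply Hm, bB].
    apply Rle_trans with (2 := H0 n); apply charge_mono; trivial; intros x []; assumption. }
  rewrite (pred_ext _ (fun x => exists n, B n x)).
  - apply (UL_sequence (sum_f_R0 (fun n => m (B n)))).
    + apply (proj2 Hm); [exact bB|].
      intros i j x Hij [H1 H2] [H3 H4].
      destruct (Nat.lt_total i j) as [h|[h|h]]; [exact (H4 _ h H1)|lia|exact (H2 _ h H3)].
    + intros e He; exists O; intros n _; replace (sum_f_R0 (fun n => m (B n)) n) with 0.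
      * unfold Rdist; rewrite Rminus_diag, Rabs_R0; exact He.
      * induction n as [|n IH]; cbn [sum_f_R0]; rewrite zB; lra.
  - intros x; split; [apply first_index|intros [n [H _]]; exists n; exact H].
Qed.

End Measures.

Lemma finmeas_push {X Y : Type} (d : X -> X -> R) (d' : Y -> Y -> R) (f : X -> Y) m :
  (forall B, borel d' B -> borel d (fun x => B (f x))) ->
  finmeas d m -> finmeas d' (fun B => m (fun x => B (f x))).
Proof.
  intros Hf [H0 H1]; split.
  - intros A HA; apply H0, Hf, HA.
  - intros A HA Hd; apply (H1 (fun n x => A n (f x))).
    + intros n; apply Hf, HA.
    + intros i j x; apply Hd.
Qed.

(** * Product measures and ultrafilters *)

Module MathCompBridge.
Import all_boot all_order all_algebra all_classical.
Import reals constructive_ereal ereal topology normedtype sequences measure lebesgue_integral Rstruct.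
Import Order.TTheory GRing.Theory Num.Theory numFieldNormedType.Exports.
Local Open Scope classical_set_scope.
Local Open Scope ring_scope.

(** An ultrafilter refining the filter of eventual sets contains all tails, hence is nonprincipal.
    Plain predicates keep the limits below independent of the filter library. *)
Lemma nonprincipal_ultrafilter : exists U : (nat -> Prop) -> Prop,
  (forall A B : nat -> Prop, (forall k, A k -> B k) -> U A -> U B) /\
  (forall A B, U A -> U B -> U (fun k => A k /\ B k)) /\
  (forall A, U A \/ U (fun k => ~ A k)) /\
  (forall A, U A -> exists k, A k) /\
  (forall N, U (fun k => (N <= k)%coq_nat)).
Proof.
have [U [UU sub]] := ultraFilterLemma (eventually_filter).
have PU : ProperFilter U by exact: ultra_proper.
exists U; split; first by move=> A B AB; exact: filterS.
split; first by move=> A B; exact: filterI.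
split; first by move=> A; exact: in_ultra_setVsetC.
split; first by move=> A; exact: filter_ex.
by move=> N; apply: sub; exists N => // k /= /ssrnat.leP.
Qed.

Lemma infinite_sumP (f : nat -> R) (l : R) :
  infinite_sum f l <-> (fun n => \sum_(0 <= i < n) f i : R^o) @ \oo --> (l : R^o).
Proof.
split=> [H|/cvgrPdist_lt H].
  apply/cvgrPdist_lt => e /RltP /H [N HN].
  (* [sum_f_R0 f n] includes the term of index [n], the sum over [0 <= i < n] does not: hence the
     shift by one. *)
  exists N.+1 => // -[//|n] /= Nn; have /HN : (n >= N)%coq_nat by apply/ssrnat.leP.
  by rewrite RdistE sum_f_R0E distrC => /RltP.
move=> e /RltP /H [N _ HN]; exists N => n /ssrnat.leP Nn.
by rewrite RdistE sum_f_R0E distrC; apply/RltP/HN => /=; exact: leqW.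
Qed.

(** * Measures of mm-spaces as MathComp measures, and their products *)

Definition carrier (X : mmspace) : Type := X.

HB.instance Definition _ X := gen_eqMixin (carrier X).
HB.instance Definition _ X := gen_choiceMixin (carrier X).
HB.instance Definition _ X := isPointed.Build (carrier X)
  (sval (cid (mm_separable X)) 0%N).
HB.instance Definition _ X := @isMeasurable.Build default_measure_display
  (carrier X) (@Borel X) (borel_False (@mm_d X)) (@borel_not _ (@mm_d X))
  (fun F mF => eq_ind _ (@Borel X) (@borel_ex _ (@mm_d X) F mF) _
     (pred_ext _ _ (fun x => conj (fun '(ex_intro n h) => ex_intro2 _ _ n I h)
        (fun '(ex_intro2 n _ h) => ex_intro _ n h)))).

Section measure_of_mmspace.
Variable X : mmspace.

(* The value on non-Borel sets is normalised to 0, because MathComp measures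
   are nonnegative on all sets. *)
Definition law (A : set (carrier X)) : \bar R :=
  if `[< Borel A >] then (mm_mu A)%:E else 0%E.

Lemma lawE A : Borel A -> law A = (mm_mu A)%:E.
Proof. by move=> bA; rewrite /law asboolT. Qed.

Let law0 : law set0 = 0%E.
Proof.
rewrite lawE; last exact: borel_False.
congr EFin; apply: (finmeas_False (@mm_d X)).
exact: (proj1 (proj1 (is_borel_probE _ _) (mm_prob X))).
Qed.

Let law_ge0 A : (0 <= law A)%E.
Proof.
rewrite /law; case: asboolP => // bA; rewrite lee_fin; apply/RleP.
by have [H _] := mm_prob X; exact: H.
Qed.

Let law_sigma_additive : semi_sigma_additive law.
Proof.
move=> F mF tF mUF; have [_ [_ H]] := mm_prob X.
rewrite lawE; last exact: mUF.
have -> : (fun n => (\sum_(0 <= i < n) law (F i))%E) =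
    (fun n => (\sum_(0 <= i < n) mm_mu (F i))%:E).
  by apply/funext => n; rewrite -sumEFin; apply: eq_bigr => i _; rewrite lawE//; exact: mF.
apply: cvg_EFin; first by near=> n.
have dF i j x : i <> j -> F i x -> F j x -> False.
  move=> /eqP ij Fi Fj; have /trivIsetP /(_ i j I I ij) := tF.
  by move/seteqP=> [/(_ x) + _]; apply; split.
have /infinite_sumP := H F mF dF.
rewrite (_ : (fun x => exists n, F n x) = \bigcup_n F n)//.
by apply/seteqP; split=> [x [n Fx]|x [n _ Fx]]; exists n.
Unshelve. all: by end_near. Qed.

HB.instance Definition _ := isMeasure.Build _ _ _ law law0 law_ge0 law_sigma_additive.

Let law_fin : fin_num_fun law.
Proof. by move=> A mA; rewrite lawE. Qed.

HB.instance Definition _ := Measure_isFinite.Build _ _ _ law law_fin.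
End measure_of_mmspace.

(** [borel] quantifies over all sigma-algebras containing the open sets, so it is instantiated with
    the product sigma-algebra; open sets belong to it as countable unions of rectangles. *)
Lemma borel_prod_measurable (X Y : mmspace) (D : X * Y -> Prop) :
  borel (prod_d X Y) D -> measurable (D : set (carrier X * carrier Y)).
Proof.
apply=> [|U /open_prod_countable [A [B [mA [mB ->]]]]].
- split; first exact: measurable0.
  split; first by move=> A; exact: measurableC.
  move=> A mA; rewrite (_ : (fun x => _) = \bigcup_n (A n : set (carrier X * carrier Y))).
    exact: bigcupT_measurable.
  by apply/seteqP; split=> [x [n Fx]|x [n _ Fx]]; exists n.
- rewrite (_ : (fun x => _) = \bigcup_n ((A n : set (carrier X)) `*` (B n : set (carrier Y)))).
    by apply: bigcupT_measurable => n; apply: measurableX; [exact: mA|exact: mB].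
  by apply/seteqP; split=> [x [n Fx]|x [n _ Fx]]; exists n.
Qed.

(** The MathComp product measure has extended real values; total mass 1 makes it finite on Borel
    sets, so [fine] preserves its sigma-additivity. Couplings are computed from the values on
    rectangles. *)
Lemma product_prob (X Y : mmspace) : exists tau : (X * Y -> Prop) -> R,
  is_borel_prob (prod_d X Y) tau /\
  forall A B, Borel A -> Borel B ->
    tau (fun p => A (fst p) /\ B (snd p)) = Rmult (mm_mu A) (mm_mu B).
Proof.
pose t := (law X \x law Y)%E.
have rect (A : set (carrier X)) (B : set (carrier Y)) : Borel A -> Borel B ->
    t (A `*` B) = (mm_mu A * mm_mu B)%:E.
  by move=> bA bB; rewrite /t product_measure1E//= !lawE.
have tT : t setT = 1%E.
  rewrite -setXTT rect; try exact: borel_True.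
  have [_ [-> _]] := mm_prob X; have [_ [-> _]] := mm_prob Y.
  by rewrite mulr1.
have tfin D : borel (prod_d X Y) D -> t D \is a fin_num.
  move=> /borel_prod_measurable mD; rewrite ge0_fin_numE ?measure_ge0//.
  by rewrite (le_lt_trans _ (ltry 1))// -tT le_measure// inE.
exists (fun D => fine (t D)); split; last first.
  by move=> A B bA bB; rewrite (_ : (fun p => _) = (A : set (carrier X)) `*` (B : set (carrier Y)))// rect.
split; first by move=> A bA; apply/RleP; rewrite fine_ge0// measure_ge0.
split; first by rewrite (_ : (fun _ => True) = setT)// tT.
move=> A bA dA; apply/infinite_sumP.
have -> : (fun x => exists n, A n x) = \bigcup_n A n.
  by apply/seteqP; split=> [x [n Fx]|x [n _ Fx]]; exists n.
have bU : borel (prod_d X Y) (\bigcup_n A n).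
  rewrite (_ : \bigcup_n A n = (fun x => exists n, A n x)); first exact: borel_ex.
  by apply/seteqP; split=> [x [n _ Fx]|x [n Fx]]; exists n.
have mA n : measurable (A n : set (carrier X * carrier Y)) by exact: borel_prod_measurable.
have tA : trivIset setT (A : nat -> set (carrier X * carrier Y)).
  apply/trivIsetP => i j _ _ /eqP ij; apply/seteqP; split=> // x [].
  exact: dA.
have := measure_semi_sigma_additive A mA tA (bigcupT_measurable _ mA) (s := t).
rewrite -[X in _ --> X](fineK (tfin _ bU)) => /fine_cvgP[_].
apply: cvg_trans; apply: near_eq_cvg; near=> n.
by rewrite /= -sum_fine// => i _; exact: tfin.
Unshelve. all: by end_near. Qed.

End MathCompBridge.

(** * Sums indexed by [in_range N] *)

(** Extension by zero turns finite and infinite [N] into one kind of sequence over [nat], so that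
    both kinds of sum become a limit of partial sums. *)
Definition mask (N : option nat) (u : nat -> R) (n : nat) : R :=
  if excluded_middle_informative (in_range N n) then u n else 0.

Lemma mask_in N u n : in_range N n -> mask N u n = u n.
Proof. intros H; unfold mask; destruct excluded_middle_informative; tauto. Qed.

Lemma mask_out N u n : ~ in_range N n -> mask N u n = 0.
Proof. intros H; unfold mask; destruct excluded_middle_informative; tauto. Qed.

Lemma mask_le N u v : (forall n, in_range N n -> u n <= v n) -> forall n, mask N u n <= mask N v n.
Proof.
  intros H n; unfold mask; destruct excluded_middle_informative; [apply H; assumption|lra].
Qed.

Lemma mask_ge0 N u : (forall n, in_range N n -> 0 <= u n) -> forall n, 0 <= mask N u n.
Proof.
  intros H n; unfold mask; destruct excluded_middle_informative; [apply H; assumption|lra].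
Qed.

Lemma fsum_ext u v n : (forall k, (1 <= k <= n)%nat -> u k = v k) -> fsum u n = fsum v n.
Proof.
  induction n as [|n IH]; intros H; cbn [fsum]; [reflexivity|].
  rewrite IH, H; [reflexivity|lia|intros k Hk; apply H; lia].
Qed.

Lemma fsum_plus u v n : fsum (fun k => u k + v k) n = fsum u n + fsum v n.
Proof. induction n as [|n IH]; cbn [fsum]; [ring|rewrite IH; ring]. Qed.

Lemma fsum_scal c u n : fsum (fun k => c * u k) n = c * fsum u n.
Proof. induction n as [|n IH]; cbn [fsum]; [ring|rewrite IH; ring]. Qed.

Lemma fsum_le u v n : (forall k, u k <= v k) -> fsum u n <= fsum v n.
Proof.
  intros H; induction n as [|n IH]; cbn [fsum]; [lra|]; specialize (H (S n)); lra.
Qed.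

Lemma fsum_incr u n m : (forall k, 0 <= u k) -> (n <= m)%nat -> fsum u n <= fsum u m.
Proof.
  intros H Hm; induction Hm as [|m _ IH]; cbn [fsum]; [lra|]; specialize (H (S m)); lra.
Qed.

Lemma sum_isP N u l : sum_is N u l <-> Un_cv (fsum (mask N u)) l.
Proof.
  destruct N as [m|]; cbn [sum_is].
  - assert (H : forall n, (m <= n)%nat -> fsum (mask (Some m) u) n = fsum u m).
    { intros n Hn; induction Hn as [|n Hn IH].
      - apply fsum_ext; intros k Hk; apply mask_in; split; lia.
      - cbn [fsum]; rewrite IH, mask_out; [ring|]; intros [_ h]; lia. }
    split.
    + intros <- e He; exists m; intros n Hn; rewrite H by exact Hn.
      unfold Rdist; rewrite Rminus_diag, Rabs_R0; exact He.
    + intros Hl; apply (UL_sequence (fsum (mask (Some m) u))); [|exact Hl].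
      intros e He; exists m; intros n Hn; rewrite H by exact Hn.
      unfold Rdist; rewrite Rminus_diag, Rabs_R0; exact He.
  - assert (H : forall n, sum_f_R0 (fun k => u (S k)) n = fsum (mask None u) (S n)).
    { assert (h : forall n, fsum (mask None u) n = fsum u n).
      { intros n; apply fsum_ext; intros k Hk; apply mask_in; split; [lia|exact I]. }
      intros n; rewrite h; induction n as [|n IH]; cbn [sum_f_R0 fsum] in *; [ring|].
      rewrite IH; reflexivity. }
    split.
    + intros Hl e He; destruct (Hl e He) as [M HM]; exists (S M); intros [|n] Hn; [lia|].
      rewrite <- H; apply HM; lia.
    + intros Hl e He; destruct (Hl e He) as [M HM]; exists M; intros n Hn.
      rewrite H; apply HM; lia.
Qed.

Lemma sum_is_ext N u v l : (forall n, in_range N n -> u n = v n) -> sum_is N u l -> sum_is N v l.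
Proof.
  intros H; rewrite !sum_isP; replace (mask N v) with (mask N u); [trivial|].
  apply functional_extensionality; intros n; unfold mask.
  destruct excluded_middle_informative; [apply H; assumption|reflexivity].
Qed.

Lemma sum_is_unique N u l l' : sum_is N u l -> sum_is N u l' -> l = l'.
Proof. rewrite !sum_isP; apply UL_sequence. Qed.

Lemma sum_is_plus N u v l l' : sum_is N u l -> sum_is N v l' ->
  sum_is N (fun n => u n + v n) (l + l').
Proof.
  rewrite !sum_isP; intros H H'; assert (h := CV_plus _ _ _ _ H H').
  replace (fsum (mask N (fun n => u n + v n)))
    with (fun n => fsum (mask N u) n + fsum (mask N v) n); [exact h|].
  apply functional_extensionality; intros n; rewrite <- fsum_plus.
  apply fsum_ext; intros k _; unfold mask; destruct excluded_middle_informative; ring.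
Qed.

Lemma sum_is_scal N c u l : sum_is N u l -> sum_is N (fun n => c * u n) (c * l).
Proof.
  rewrite !sum_isP; intros H.
  assert (h : Un_cv (fun _ => c) c).
  { intros e He; exists O; intros n _; unfold Rdist; rewrite Rminus_diag, Rabs_R0; exact He. }
  assert (h' := CV_mult _ _ _ _ h H).
  replace (fsum (mask N (fun n => c * u n))) with (fun n => c * fsum (mask N u) n); [exact h'|].
  apply functional_extensionality; intros n; rewrite <- fsum_scal.
  apply fsum_ext; intros k _; unfold mask; destruct excluded_middle_informative; ring.
Qed.

Lemma sum_is_fin_sum N (u : nat -> nat -> R) (l : nat -> R) J :
  (forall j, (j <= J)%nat -> sum_is N (u j) (l j)) ->
  sum_is N (fun n => sum_f_R0 (fun j => u j n) J) (sum_f_R0 l J).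
Proof.
  induction J as [|J IH]; intros H; cbn [sum_f_R0]; [apply H, le_n|].
  apply (sum_is_plus N (fun n => sum_f_R0 (fun j => u j n) J)).
  - apply IH; intros j Hj; apply H; lia.
  - apply H, le_n.
Qed.

Lemma Un_cv_le_const (w : nat -> R) l c m :
  Un_cv w l -> (forall n, (m <= n)%nat -> w n <= c) -> l <= c.
Proof.
  intros Hw H; apply Rnot_lt_le; intros Hl.
  destruct (Hw (l - c)) as [M HM]; [lra|].
  specialize (HM (max m M)); specialize (H (max m M)).
  assert (h := H ltac:(lia)); assert (h' := HM ltac:(lia)).
  unfold Rdist in h'; apply Rabs_def2 in h'; lra.
Qed.

Lemma Un_cv_ge_const (w : nat -> R) l c m :
  Un_cv w l -> (forall n, (m <= n)%nat -> c <= w n) -> c <= l.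
Proof.
  intros Hw H; apply Rnot_lt_le; intros Hl.
  destruct (Hw (c - l)) as [M HM]; [lra|].
  specialize (HM (max m M)); specialize (H (max m M)).
  assert (h := H ltac:(lia)); assert (h' := HM ltac:(lia)).
  unfold Rdist in h'; apply Rabs_def2 in h'; lra.
Qed.

Lemma sum_is_partial N u l m : (forall n, in_range N n -> 0 <= u n) -> sum_is N u l ->
  fsum (mask N u) m <= l.
Proof.
  intros H0 H; rewrite sum_isP in H.
  apply (Un_cv_ge_const (fsum (mask N u)) l _ m); [exact H|].
  intros n Hn; apply fsum_incr; [apply mask_ge0, H0|exact Hn].
Qed.

Lemma sum_is_term N u l n : (forall n, in_range N n -> 0 <= u n) -> sum_is N u l ->
  in_range N n -> u n <= l.
Proof.
  intros H0 H Hn; apply Rle_trans with (2 := sum_is_partial N u l n H0 H).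
  assert (h := mask_in N u n Hn); destruct n as [|n]; [destruct Hn; lia|].
  cbn [fsum]; rewrite h.
  assert (fsum (mask N u) 0 <= fsum (mask N u) n).
  { apply fsum_incr; [apply mask_ge0, H0|lia]. }
  cbn [fsum] in *; lra.
Qed.

Lemma sum_is_exists N u v L : (forall n, in_range N n -> 0 <= u n <= v n) -> sum_is N v L ->
  exists l, 0 <= l /\ sum_is N u l.
Proof.
  intros Hu Hv.
  assert (H0 : forall n, 0 <= mask N u n) by (apply mask_ge0; intros n Hn; apply Hu, Hn).
  destruct (growing_cv (fsum (mask N u))) as [l Hl].
  - intros n; cbn [fsum]; specialize (H0 (S n)); lra.
  - exists L; intros x [n ->].
    apply Rle_trans with (fsum (mask N v) n).
    + apply fsum_le, mask_le; intros k Hk; apply Hu, Hk.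
    + apply sum_is_partial; [|exact Hv]; intros k Hk; specialize (Hu k Hk); lra.
  - exists l; rewrite sum_isP; split; [|exact Hl].
    apply (Un_cv_ge_const _ _ _ O Hl); intros n _.
    apply (fsum_incr (mask N u) O n); [exact H0|lia].
Qed.

(** The tail of [u] is bounded by that of [v], so [M] depends on [v] and [e] alone. This uniformity
    is what allows a limit and a series to be interchanged. *)
Lemma sum_is_uniform_tail N v L : (forall n, in_range N n -> 0 <= v n) -> sum_is N v L ->
  forall e, 0 < e -> exists M, forall u l,
    (forall n, in_range N n -> 0 <= u n <= v n) -> sum_is N u l ->
    forall m, (M <= m)%nat -> l <= fsum (mask N u) m + e.
Proof.
  intros H0 Hv e He; assert (HvL := Hv); rewrite sum_isP in Hv.
  destruct (Hv e He) as [M HM]; exists M; intros u l Hu Hl m Hm.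
  rewrite sum_isP in Hl; apply (Un_cv_le_const _ _ _ m Hl); intros n Hn.
  assert (h : fsum (mask N u) n - fsum (mask N u) m <= fsum (mask N v) n - fsum (mask N v) m).
  { induction Hn as [|n Hn IH]; [lra|]; cbn [fsum].
    assert (mask N u (S n) <= mask N v (S n)); [|lra].
    apply mask_le; intros k Hk; apply Hu, Hk. }
  specialize (HM m Hm); unfold Rdist in HM; apply Rabs_def2 in HM.
  assert (h' := sum_is_partial N v L n H0 HvL); lra.
Qed.

Lemma finmeas_zero {X : Type} (d : X -> X -> R) : finmeas d (fun _ => 0).
Proof.
  split; [intros; lra|]; intros A _ _ e He; exists O; intros n _.
  replace (sum_f_R0 (fun _ => 0) n) with 0.
  - unfold Rdist; rewrite Rminus_diag, Rabs_R0; exact He.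
  - induction n as [|n IH]; cbn [sum_f_R0]; lra.
Qed.

Lemma prob_charge {X : Type} (d : X -> X -> R) m : is_borel_prob d m -> charge d m.
Proof. rewrite is_borel_probE; intros [H _]; apply finmeas_charge, H. Qed.

Lemma prob_le1 {X : Type} (d : X -> X -> R) m B : is_borel_prob d m -> borel d B -> m B <= 1.
Proof.
  intros H HB; rewrite <- (proj1 (proj2 H)); apply (charge_mono d); trivial.
  - apply prob_charge, H.
  - apply borel_True.
Qed.

(** Values are chosen set by set, and uniqueness of sums gives finite additivity. The terms beyond
    [M] contribute at most [e] on every Borel set, so the mixture is dominated up to [e] by a
    partial sum, which is a finite measure. *)
Lemma prob_series {X : Type} (d : X -> X -> R) N a (nu : nat -> (X -> Prop) -> R) :
  in_A1 N a -> (forall n, in_range N n -> is_borel_prob d (nu n)) ->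
  exists m, is_borel_prob d m /\
    forall B, borel d B -> sum_is N (fun n => a n * nu n B) (m B).
Proof.
  intros [Ha Hs] Hnu.
  assert (Hb : forall B, borel d B -> forall n, in_range N n -> 0 <= a n * nu n B <= a n).
  { intros B HB n Hn; specialize (Ha n Hn).
    assert (h := proj1 (Hnu n Hn) B HB); assert (h' := prob_le1 d (nu n) B (Hnu n Hn) HB); nra. }
  assert (Hex : forall B, exists l, borel d B -> 0 <= l /\ sum_is N (fun n => a n * nu n B) l).
  { intros B; destruct (classic (borel d B)) as [HB|HB]; [|exists 0; tauto].
    destruct (sum_is_exists N _ a 1 (Hb B HB) Hs) as [l Hl]; exists l; tauto. }
  destruct (choice_fun _ Hex) as [m Hm].
  exists m; split; [|intros B HB; apply Hm, HB].
  apply is_borel_probE; split.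
  - apply charge_dominated.
    + split; [intros B HB; apply Hm, HB|]; intros A B HA HB Hd.
      apply (sum_is_unique N (fun n => a n * nu n (fun x => A x \/ B x))).
      * apply Hm, borel_or; assumption.
      * apply sum_is_ext with (fun n => a n * nu n A + a n * nu n B).
        -- intros n Hn; rewrite (proj2 (prob_charge d _ (Hnu n Hn))) by assumption; ring.
        -- apply sum_is_plus; apply Hm; assumption.
    + intros e He.
      destruct (sum_is_uniform_tail N a 1) with (e := e) as [M HM]; trivial.
      { intros n Hn; specialize (Ha n Hn); lra. }
      exists (fun B => fsum (mask N (fun n => a n * nu n B)) M), 1; split; [|split; [lra|]].
      * clear HM; induction M as [|M IH]; cbn [fsum]; [apply finmeas_zero|].
        apply (finmeas_plus d _ (fun B => mask N (fun n => a n * nu n B) (S M)) IH).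
        destruct (classic (in_range N (S M))) as [h|h].
        -- replace (fun B => mask N (fun n => a n * nu n B) (S M))
             with (fun B => a (S M) * nu (S M) B)
             by (apply functional_extensionality; intros B; symmetry; apply mask_in, h).
           apply finmeas_scal; [specialize (Ha _ h); lra|].
           apply is_borel_probE, Hnu, h.
        -- replace (fun B => mask N (fun n => a n * nu n B) (S M)) with (fun _ : X -> Prop => 0)
             by (apply functional_extensionality; intros B; symmetry; apply mask_out, h).
           apply finmeas_zero.
      * intros B HB; rewrite Rmult_1_l.
        apply (HM _ _ (Hb B HB)); [apply Hm, HB|lia].
  - apply (sum_is_unique N (fun n => a n * nu n (fun _ => True))).
    + apply Hm, borel_True.
    + apply sum_is_ext with a; [|exact Hs].
      intros n Hn; rewrite (proj1 (proj2 (Hnu n Hn))); ring.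
Qed.

(** * Direct sums as decompositions of the measure *)

(** Carrier and metric are unchanged by conversion, so Borel sets, maps and labellings of [X] serve
    the new space as they stand. *)
Definition with_measure (X : mmspace) (nu : (X -> Prop) -> R)
    (h : is_borel_prob (@mm_d X) nu) : mmspace :=
  MMSpace X (@mm_d X) nu (mm_is_metric X) (mm_complete X) (mm_separable X) h.

Lemma metric_refl (X : mmspace) (x : X) : mm_d x x = 0.
Proof. apply (mm_is_metric X); reflexivity. Qed.

Lemma metric_sym (X : mmspace) (x y : X) : mm_d x y = mm_d y x.
Proof. apply (mm_is_metric X). Qed.

Lemma metric_tri (X : mmspace) (x y z : X) : mm_d x z <= mm_d x y + mm_d y z.
Proof. apply (mm_is_metric X). Qed.

Lemma mm_finmeas (X : mmspace) : finmeas (@mm_d X) (@mm_mu X).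
Proof. apply is_borel_probE, mm_prob. Qed.

Lemma mm_charge (X : mmspace) : charge (@mm_d X) (@mm_mu X).
Proof. apply prob_charge, mm_prob. Qed.

Lemma mm_mu_True (X : mmspace) : mm_mu (fun _ : X => True) = 1.
Proof. apply (mm_prob X). Qed.

(** * Supports *)

Lemma borel_ball (X : mmspace) (x : X) r : Borel (Defs.ball mm_d x r).
Proof.
  apply borel_open; unfold Defs.ball; intros y Hy; exists (r - mm_d x y); split; [lra|].
  intros z Hz; assert (h := metric_tri X x y z); lra.
Qed.

(** If the ball of radius [r] about [x] is null, so is the ball of radius [r / 2] about any point
    within [r / 2] of [x]; the complement is therefore open. *)
Lemma borel_Supp (X : mmspace) : Borel (Supp X).
Proof.
  rewrite (pred_ext (Supp X) (fun x => ~ ~ Supp X x)) by (split; [tauto|apply NNPP]).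
  apply borel_not, borel_open; intros x Hx.
  apply not_all_ex_not in Hx; destruct Hx as [r Hx].
  apply imply_to_and in Hx; destruct Hx as [Hr Hx].
  exists (r / 2); split; [lra|]; intros y Hy HS; apply Hx.
  apply Rlt_le_trans with (1 := HS (r / 2) ltac:(lra)).
  apply (charge_mono mm_d); [apply mm_charge|apply borel_ball|apply borel_ball|].
  unfold Defs.ball; intros z Hz; assert (h := metric_tri X x y z); lra.
Qed.

(** Each point outside the support lies in a null ball whose centre is in the dense sequence and
    whose radius is the inverse of an integer; there are countably many such balls. *)
Lemma Supp_full (X : mmspace) : mm_mu (fun x => ~ Supp X x) = 0.
Proof.
  destruct (mm_separable X) as [s Hs].
  pose (A n (x : X) := mm_mu (Defs.ball mm_d (s (fst (of_nat n))) (/ INR (S (snd (of_nat n))))) <= 0 /\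
     Defs.ball mm_d (s (fst (of_nat n))) (/ INR (S (snd (of_nat n)))) x).
  assert (bA : forall n, Borel (A n)).
  { intros n; apply borel_and; [apply borel_const|apply borel_ball]. }
  assert (z : mm_mu (fun x => exists n, A n x) = 0).
  { apply (finmeas_null_union mm_d); [apply mm_finmeas|exact bA|]; intros n.
    set (Q := mm_mu (Defs.ball mm_d (s (fst (of_nat n))) (/ INR (S (snd (of_nat n))))) <= 0) in A.
    destruct (classic Q) as [h|h].
    - apply Rle_trans with (2 := h); apply (charge_mono mm_d);
        [apply mm_charge|apply bA|apply borel_ball|intros x []; assumption].
    - rewrite (pred_ext (A n) (fun _ => False)) by (unfold A; tauto).
      rewrite (charge_False mm_d) by apply mm_charge; lra. }
  apply Rle_antisym; [rewrite <- z|apply mm_finmeas, borel_not, borel_Supp].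
  apply (charge_mono mm_d); [apply mm_charge|apply borel_not, borel_Supp|apply borel_ex, bA|].
  intros x Hx; apply not_all_ex_not in Hx; destruct Hx as [r Hx].
  apply imply_to_and in Hx; destruct Hx as [Hr Hx].
  destruct (small_inv (r / 2)) as [m Hm]; [lra|].
  destruct (Hs x _ (inv_INR_pos m)) as [n Hn].
  exists (to_nat (n, m)); unfold A; rewrite cancel_of_to; cbn [fst snd].
  unfold Defs.ball at 2; rewrite metric_sym; split; [|exact Hn].
  apply Rnot_lt_le; intros H; apply Hx; apply Rlt_le_trans with (1 := H).
  apply (charge_mono mm_d); [apply mm_charge|apply borel_ball|apply borel_ball|].
  unfold Defs.ball; intros y Hy; assert (h := metric_tri X x (s n) y); lra.
Qed.

Lemma charge_conull {X : Type} (d : X -> X -> R) m C B : charge d m ->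
  borel d C -> borel d B -> m (fun x => ~ C x) = 0 -> m (fun x => C x /\ B x) = m B.
Proof.
  intros Hm HC HB H0; rewrite (charge_split d m B C Hm HB HC).
  rewrite (pred_ext (fun x => B x /\ C x) (fun x => C x /\ B x)) by tauto.
  enough (m (fun x => B x /\ ~ C x) = 0) by lra.
  apply Rle_antisym; [rewrite <- H0; apply (charge_mono d)|apply Hm]; trivial;
    try (apply borel_and; trivial); try apply borel_not; tauto.
Qed.

(** [f] is controlled on [C] alone, so preimages of open sets are open relative to [C]: they are
    traces of unions of balls around points [x0] of [C], with radii for which the ball about [f x0]
    stays in [U]. *)
Lemma borel_preim_on (X Y : mmspace) (C : X -> Prop) (f : X -> Y) :
  Borel C -> (forall x x', C x -> C x' -> mm_d (f x) (f x') <= mm_d x x') ->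
  forall B, Borel B -> Borel (fun x => C x /\ B (f x)).
Proof.
  intros HC Hf B HB; apply (HB (fun B => Borel (fun x => C x /\ B (f x)))).
  - split; [|split].
    + rewrite (pred_ext _ (fun _ : X => False)) by tauto; apply borel_False.
    + intros A HA; rewrite (pred_ext _ (fun x => C x /\ ~ (C x /\ A (f x)))) by tauto.
      apply borel_and; [exact HC|apply borel_not, HA].
    + intros A HA; rewrite (pred_ext _ (fun x => exists n, C x /\ A n (f x))) by firstorder.
      apply borel_ex, HA.
  - intros U HU.
    rewrite (pred_ext _ (fun x => C x /\ exists x0 r, C x0 /\ mm_d x0 x < r /\
        forall z, mm_d (f x0) z < r -> U z)).
    + apply borel_and; [exact HC|apply borel_open].
      intros x [x0 [r [H0 [H1 H2]]]]; exists (r - mm_d x0 x); split; [lra|].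
      intros y Hy; exists x0, r; repeat split; trivial.
      assert (h := metric_tri X x0 x y); lra.
    + intros x; split; intros [Hx H]; (split; [exact Hx|]).
      * destruct (HU _ H) as [r [Hr h]]; exists x, r; rewrite metric_refl; tauto.
      * destruct H as [x0 [r [H0 [H1 H2]]]]; apply H2.
        specialize (Hf x0 x H0 Hx); lra.
Qed.

(** * Isomorphisms between supports *)

Lemma mm_iso_refl (X : mmspace) : mm_iso X X.
Proof.
  exists (fun x => x); repeat split; trivial; [intros y Hy; exists y; tauto|].
  intros B HB; symmetry; apply (charge_conull mm_d); trivial.
  - apply mm_charge.
  - apply borel_Supp.
  - apply Supp_full.
Qed.

(** Symmetric in the two spaces, unlike [mm_iso]. The inverse matters because [direct_sum] supplies
    a map out of [X], while the summands live on the target and must be brought back. *)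
Definition iso_pair (X Y : mmspace) (F : X -> Y) (G : Y -> X) : Prop :=
  (forall x, Supp X x -> Supp Y (F x) /\ G (F x) = x) /\
  (forall y, Supp Y y -> Supp X (G y) /\ F (G y) = y) /\
  (forall x x', Supp X x -> Supp X x' -> mm_d (F x) (F x') = mm_d x x') /\
  (forall y y', Supp Y y -> Supp Y y' -> mm_d (G y) (G y') = mm_d y y') /\
  (forall B, Borel B -> mm_mu B = mm_mu (fun x => Supp X x /\ B (F x))) /\
  (forall B, Borel B -> mm_mu B = mm_mu (fun y => Supp Y y /\ B (G y))).

Lemma mm_iso_pair (X Y : mmspace) : mm_iso X Y -> exists F G, iso_pair X Y F G.
Proof.
  intros [F [HF [Hsur [Hiso Hmu]]]].
  destruct (mm_separable X) as [s _].
  assert (Hex : forall y, exists x, Supp Y y -> Supp X x /\ F x = y).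
  { intros y; destruct (classic (Supp Y y)) as [h|h].
    - destruct (Hsur y h) as [x Hx]; exists x; tauto.
    - exists (s O); tauto. }
  destruct (choice_fun _ Hex) as [G HG].
  assert (Hinv : forall x, Supp X x -> G (F x) = x).
  { intros x Hx; destruct (HG (F x) (HF x Hx)) as [h1 h2].
    apply (mm_is_metric X); rewrite <- Hiso, h2 by assumption; apply metric_refl. }
  assert (HGiso : forall y y', Supp Y y -> Supp Y y' -> mm_d (G y) (G y') = mm_d y y').
  { intros y y' Hy Hy'; destruct (HG y Hy) as [h1 h2], (HG y' Hy') as [h1' h2'].
    rewrite <- Hiso, h2, h2' by assumption; reflexivity. }
  exists F, G; repeat split; trivial; try (apply HG; assumption).
  - apply HF; assumption.
  - apply Hinv; assumption.
  (* The formula for [F] is applied to the preimage of [B] under [G]; then [G (F x) = x] on the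
     support, which is conull. *)
  - intros B HB; rewrite Hmu.
    + transitivity (mm_mu (fun x => Supp X x /\ B x)).
      * symmetry; apply (charge_conull mm_d); trivial;
          [apply mm_charge|apply borel_Supp|apply Supp_full].
      * f_equal; apply pred_ext; intros x; split; intros [Hx h]; (split; [exact Hx|]).
        -- rewrite (Hinv x Hx); split; [apply HF|]; assumption.
        -- rewrite (Hinv x Hx) in h; tauto.
    + apply borel_preim_on; trivial; [apply borel_Supp|].
      intros y y' Hy Hy'; rewrite HGiso by assumption; lra.
Qed.

Lemma iso_pair_sym X Y F G : iso_pair X Y F G -> iso_pair Y X G F.
Proof. unfold iso_pair; tauto. Qed.

Lemma iso_pair_mm_iso X Y F G : iso_pair X Y F G -> mm_iso X Y.
Proof.
  intros [H1 [H2 [H3 [H4 [H5 H6]]]]]; exists F; repeat split; trivial.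
  - intros x Hx; apply H1, Hx.
  - intros y Hy; exists (G y); apply H2, Hy.
Qed.

Lemma mm_iso_sym X Y : mm_iso X Y -> mm_iso Y X.
Proof.
  intros H; destruct (mm_iso_pair X Y H) as [F [G h]].
  apply (iso_pair_mm_iso Y X G F), iso_pair_sym, h.
Qed.

(* The support of [nu] sits inside that of [mm_mu], so an isomorphism, although
   only meaningful on supports, carries [nu] along. *)
Lemma iso_pair_transport X Y F G nu h : iso_pair X Y F G ->
  (forall B, Borel B -> mm_mu B = 0 -> nu B = 0) ->
  exists h', mm_iso (with_measure X nu h)
    (with_measure Y (fun B => nu (fun x => Supp X x /\ B (F x))) h').
Proof.
  intros [H1 [H2 [H3 [H4 [H5 H6]]]]] Hac.
  assert (Cnu : charge mm_d nu) by apply prob_charge, h.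
  assert (bF : forall B, Borel B -> Borel (fun x => Supp X x /\ B (F x))).
  { apply borel_preim_on; [apply borel_Supp|].
    intros x x' Hx Hx'; rewrite H3 by assumption; lra. }
  assert (nS : nu (fun x => ~ Supp X x) = 0).
  { apply Hac; [apply borel_not, borel_Supp|apply Supp_full]. }
  assert (full : forall B, Borel B -> nu (fun x => Supp X x /\ B x) = nu B).
  { intros B HB; apply (charge_conull mm_d); trivial; apply borel_Supp. }
  (* [F] preserves distances on the support, so corresponding balls have equal mass; this matches
     the supports of [nu] and of its image. *)
  assert (ball_eq : forall x r, Supp X x ->
    nu (fun x' => Supp X x' /\ Defs.ball mm_d (F x) r (F x')) = nu (Defs.ball mm_d x r)).
  { intros x r Hx; rewrite <- (full (Defs.ball mm_d x r)) by apply borel_ball.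
    f_equal; apply pred_ext; intros x'; unfold Defs.ball; split; intros [Hx' Hd];
      (split; [exact Hx'|]); rewrite H3 in *; assumption. }
  assert (sub : forall x, supp mm_d nu x -> Supp X x).
  { intros x Hx r Hr; destruct (proj1 (mm_finmeas X) _ (borel_ball X x r)) as [|Hz]; trivial.
    specialize (Hx r Hr); rewrite Hac in Hx; [lra|apply borel_ball|auto]. }
  assert (h' : is_borel_prob (@mm_d Y) (fun B => nu (fun x => Supp X x /\ B (F x)))).
  { destruct h as [h0 [h1 h2]]; split; [|split].
    - intros B HB; apply h0, bF, HB.
    - rewrite (full (fun _ => True)) by apply borel_True; exact h1.
    - intros A HA Hd.
      rewrite (pred_ext (fun x => Supp X x /\ exists n, A n (F x))
        (fun x => exists n, Supp X x /\ A n (F x))) by firstorder.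
      apply (h2 (fun n x => Supp X x /\ A n (F x))).
      + intros n; apply bF, HA.
      + intros i j x Hij [] []; eapply Hd; eassumption. }
  exists h', F; split; [|split; [|split]].
  - intros x Hx r Hr; cbn; rewrite ball_eq by apply sub, Hx; apply Hx, Hr.
  - intros y Hy; cbn in y.
    assert (Sy : Supp Y y).
    { intros r Hr; specialize (Hy r Hr); cbn in Hy.
      rewrite H5 by apply borel_ball.
      destruct (proj1 (mm_finmeas X) _ (bF _ (borel_ball Y y r))) as [|Hz]; trivial.
      rewrite Hac in Hy; [lra|apply bF, borel_ball|auto]. }
    destruct (H2 y Sy) as [Sx Ex]; exists (G y); split; [|exact Ex].
    intros r Hr; cbn; rewrite <- ball_eq, Ex by exact Sx; apply Hy, Hr.
  - intros x x' Hx Hx'; apply H3; apply sub; assumption.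
  - intros B HB; cbn.
    assert (bS : Borel (Supp (with_measure X nu h))) by apply (borel_Supp (with_measure X nu h)).
    transitivity (nu (fun x => Supp (with_measure X nu h) x /\ (Supp X x /\ B (F x)))).
    + symmetry; apply (charge_conull mm_d); trivial; [apply bF, HB|].
      apply (Supp_full (with_measure X nu h)).
    + f_equal; apply pred_ext; intros x; split; [tauto|].
      intros [Hx HBx]; repeat split; trivial; apply sub, Hx.
Qed.

(** * Passage between direct sums and splittings *)

Definition splits (N : option nat) (a : nat -> R) (P : nat -> mmspace -> Prop) (X : mmspace) : Prop :=
  exists nu : nat -> (X -> Prop) -> R,
    (forall n, in_range N n -> exists h, P n (with_measure X (nu n) h)) /\
    (forall B, Borel B -> sum_is N (fun n => a n * nu n B) (mm_mu B)).

Definition lip_closed (P : mmspace -> Prop) : Prop :=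
  forall X Y, P Y -> lip_prec X Y -> P X.

Lemma lipschitz_push (X Y : mmspace) (f : X -> Y) : one_lipschitz f ->
  exists h, lip_prec (with_measure Y (fun B => mm_mu (fun x => B (f x))) h) X.
Proof.
  intros Hf.
  assert (h : is_borel_prob (@mm_d Y) (fun B => mm_mu (fun x => B (f x)))).
  { apply is_borel_probE; split; [|apply mm_mu_True].
    apply (finmeas_push mm_d mm_d f); [|apply mm_finmeas].
    apply borel_preim_lipschitz, Hf. }
  exists h, f; split; [exact Hf|reflexivity].
Qed.

(** A term of a nonnegative series is at most the sum. This makes each summand absolutely continuous
    and, after division by [a n], bounds its density. *)
Lemma summand_dominated N a (X : Type) (d : X -> X -> R) (nu : nat -> (X -> Prop) -> R) mu n B :
  in_A1 N a -> (forall k, in_range N k -> is_borel_prob d (nu k)) ->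
  (forall B, borel d B -> sum_is N (fun k => a k * nu k B) (mu B)) ->
  in_range N n -> borel d B -> a n * nu n B <= mu B.
Proof.
  intros [Ha _] Hnu Hs Hn HB.
  apply (sum_is_term N (fun k => a k * nu k B)); [|apply Hs, HB|exact Hn].
  intros k Hk; apply Rmult_le_pos; [specialize (Ha k Hk); lra|apply Hnu; assumption].
Qed.

(** The image of [Xs n] on [X'] stays in [P n] by Lipschitz closure. The inverse isomorphism carries
    it to [X], which is legitimate because null sets of [X'] are null for every summand. *)
Lemma splits_of_direct_sum N a P X : in_A1 N a ->
  (forall n, in_range N n -> iso_invariant (P n)) ->
  (forall n, in_range N n -> lip_closed (P n)) ->
  direct_sum N a P X -> splits N a P X.
Proof.
  intros HA Hiso Hdown [X' [HX [Xs [f [HP [Hlip Hmu]]]]]].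
  destruct (mm_iso_pair _ _ HX) as [F [G HFG]].
  pose (nu' n (B : X' -> Prop) := mm_mu (fun x => B (f n x))).
  assert (Hpr : forall n, in_range N n -> is_borel_prob (@mm_d X') (nu' n)).
  { intros n Hn; destruct (lipschitz_push _ _ _ (Hlip n Hn)) as [h _]; exact h. }
  exists (fun n B => nu' n (fun y => Supp X' y /\ B (G y))); split.
  - intros n Hn; destruct (lipschitz_push _ _ _ (Hlip n Hn)) as [h Hh].
    destruct (iso_pair_transport X' X G F (nu' n) h (iso_pair_sym _ _ _ _ HFG)) as [h' Hi].
    + intros B HB Hz; apply Rle_antisym; [|apply (Hpr n Hn), HB].
      assert (H := summand_dominated N a X' mm_d nu' mm_mu n B HA Hpr Hmu Hn HB).
      destruct HA as [Ha _]; specialize (Ha n Hn); rewrite Hz in H; nra.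
    + exists h'; apply (Hiso n Hn _ _ Hi), (Hdown n Hn _ (Xs n)); [apply HP, Hn|exact Hh].
  - intros B HB; destruct HFG as [H1 [H2 [H3 [H4 [H5 H6]]]]]; rewrite H6 by exact HB.
    apply Hmu, borel_preim_on; trivial; [apply borel_Supp|].
    intros y y' Hy Hy'; rewrite H4 by assumption; lra.
Qed.

(** The summands are [Y] with the measures [nu n], mapped by the identity. A space and its map are
    chosen together as a dependent pair; indices out of range receive [Y] itself. *)
Lemma direct_sum_of_splits N a P X Y : mm_iso X Y -> splits N a P Y -> direct_sum N a P X.
Proof.
  intros HXY [nu [HP Hs]]; exists Y; split; [exact HXY|].
  assert (Hex : forall n, exists Z : {Z : mmspace & Z -> Y}, in_range N n ->
    P n (projT1 Z) /\ one_lipschitz (projT2 Z) /\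
    forall B, mm_mu (preim (projT2 Z) B) = nu n B).
  { intros n; destruct (classic (in_range N n)) as [Hn|Hn].
    - destruct (HP n Hn) as [h Hh].
      exists (existT (fun Z : mmspace => Z -> Y) (with_measure Y (nu n) h) (fun y => y)); intros _; cbn.
      split; [exact Hh|split; [|reflexivity]]; intros y y'; apply Rle_refl.
    - exists (existT (fun Z : mmspace => Z -> Y) Y (fun y => y)); tauto. }
  destruct (choice_fun _ Hex) as [Z HZ].
  exists (fun n => projT1 (Z n)), (fun n => projT2 (Z n)).
  split; [|split].
  - intros n Hn; apply (HZ n Hn).
  - intros n Hn; apply (HZ n Hn).
  - intros B HB; apply sum_is_ext with (2 := Hs B HB); intros n Hn.
    f_equal; symmetry; apply (HZ n Hn).
Qed.

(** * Lipschitz images and common dominators *)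

Lemma in_A1_range1 N a : in_A1 N a -> in_range N 1.
Proof.
  intros [_ H]; split; [lia|]; destruct N as [[|m]|]; [cbn in H; lra|lia|exact I].
Qed.

Lemma sum_is_convex_const N a c : in_A1 N a -> sum_is N (fun n => a n * c) c.
Proof.
  intros [_ H]; apply (sum_is_scal N c) in H; rewrite Rmult_1_r in H.
  apply sum_is_ext with (2 := H); intros; ring.
Qed.

Lemma prob_const {X : Type} (d : X -> X -> R) m (Q : Prop) : is_borel_prob d m ->
  m (fun _ => Q) = if excluded_middle_informative Q then 1 else 0.
Proof.
  intros H; destruct excluded_middle_informative as [h|h].
  - rewrite (pred_ext (fun _ => Q) (fun _ : X => True)) by tauto; apply H.
  - rewrite (pred_ext (fun _ => Q) (fun _ : X => False)) by tauto.
    apply (charge_False d), prob_charge, H.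
Qed.

(** The one-point space is a Lipschitz image of every mm-space, hence lies in every [P n]. Its point
    mass is written as the image of a given probability measure. *)
Lemma splits_nonempty N a P : in_A1 N a ->
  (forall n, in_range N n -> lip_closed (P n)) ->
  (forall n, in_range N n -> exists X, P n X) -> exists X, splits N a P X.
Proof.
  intros HA Hdown Hex; destruct (Hex 1%nat (in_A1_range1 N a HA)) as [X _].
  assert (hd : is_metric (fun _ _ : unit => 0)).
  { repeat split; intros; try lra; destruct x, y; reflexivity. }
  assert (hc : complete_metric (fun _ _ : unit => 0)).
  { intros u _; exists tt; intros e He; exists O; intros; exact He. }
  assert (hs : separable_metric (fun _ _ : unit => 0)).
  { exists (fun _ => tt); intros x e He; exists O; exact He. }
  assert (hm : is_borel_prob (fun _ _ : unit => 0) (fun B => mm_mu (fun _ : X => B tt))).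
  { apply is_borel_probE; split; [|apply mm_mu_True].
    apply (finmeas_push (@mm_d X) _ (fun _ => tt)); [|apply mm_finmeas].
    intros B _; apply borel_const. }
  pose (pt := MMSpace unit (fun _ _ => 0) (fun B => mm_mu (fun _ : X => B tt)) hd hc hs hm).
  exists pt, (fun _ => @mm_mu pt); split.
  - intros n Hn; exists hm; destruct (Hex n Hn) as [Y HY].
    apply (Hdown n Hn _ Y HY); exists (fun _ => tt); split.
    + intros y y'; apply (mm_is_metric Y).
    + intros B _; cbn; unfold preim.
      rewrite !(prob_const mm_d) by apply mm_prob; reflexivity.
  - intros B _; apply sum_is_convex_const, HA.
Qed.

Lemma splits_lip_closed N a P : (forall n, in_range N n -> lip_closed (P n)) ->
  lip_closed (splits N a P).
Proof.
  intros Hdown X Y [nu [HP Hs]] [f [Hf Hmu]].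
  exists (fun n B => nu n (fun y => B (f y))); split.
  - intros n Hn; destruct (HP n Hn) as [h Hh].
    destruct (lipschitz_push (with_measure Y (nu n) h) X f Hf) as [h' Hp].
    exists h'; exact (Hdown n Hn _ _ Hh Hp).
  - intros B HB; rewrite Hmu by exact HB; apply Hs.
    apply (borel_preim_lipschitz mm_d mm_d f Hf B HB).
Qed.

(** * Products with the max metric *)

Lemma prod_metric X Y : is_metric (prod_d X Y).
Proof.
  destruct (mm_is_metric X) as [p1 [z1 [s1 t1]]], (mm_is_metric Y) as [p2 [z2 [s2 t2]]].
  unfold prod_d; split; [|split; [|split]].
  - intros p q; apply Rle_trans with (1 := p1 (fst p) (fst q)), Rmax_l.
  - intros [x y] [x' y']; cbn [fst snd]; split.
    + intros H; assert (h1 := Rmax_l (mm_d x x') (mm_d y y')).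
      assert (h2 := Rmax_r (mm_d x x') (mm_d y y')).
      specialize (p1 x x'); specialize (p2 y y').
      f_equal; [apply z1|apply z2]; lra.
    + intros H; injection H as -> ->; rewrite !metric_refl; apply Rmax_left; lra.
  - intros p q; rewrite s1, s2; reflexivity.
  - intros p q r; specialize (t1 (fst p) (fst q) (fst r)); specialize (t2 (snd p) (snd q) (snd r)).
    apply Rmax_lub; eapply Rle_trans; try eassumption;
      apply Rplus_le_compat; apply Rmax_l || apply Rmax_r.
Qed.

Lemma prod_complete X Y : complete_metric (prod_d X Y).
Proof.
  intros u Hu.
  destruct (mm_complete X (fun n => fst (u n))) as [x Hx].
  { intros e He; destruct (Hu e He) as [N HN]; exists N; intros m n Hm Hn.
    apply Rle_lt_trans with (2 := HN m n Hm Hn), Rmax_l. }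
  destruct (mm_complete Y (fun n => snd (u n))) as [y Hy].
  { intros e He; destruct (Hu e He) as [N HN]; exists N; intros m n Hm Hn.
    apply Rle_lt_trans with (2 := HN m n Hm Hn), Rmax_r. }
  exists (x, y); intros e He; destruct (Hx e He) as [N1 H1], (Hy e He) as [N2 H2].
  exists (max N1 N2); intros n Hn; apply Rmax_lub_lt; [apply H1|apply H2]; lia.
Qed.

Lemma prod_separable X Y : separable_metric (prod_d X Y).
Proof.
  destruct (mm_separable X) as [s Hs], (mm_separable Y) as [t Ht].
  exists (fun n => (s (fst (of_nat n)), t (snd (of_nat n)))); intros [x y] e He.
  destruct (Hs x e He) as [i Hi], (Ht y e He) as [j Hj].
  exists (to_nat (i, j)); rewrite cancel_of_to; apply Rmax_lub_lt; assumption.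
Qed.

Definition prod_space (X Y : mmspace) tau (h : is_borel_prob (prod_d X Y) tau) : mmspace :=
  MMSpace (X * Y) (prod_d X Y) tau (prod_metric X Y) (prod_complete X Y) (prod_separable X Y) h.

Lemma fst_lipschitz (X Y : mmspace) (p q : X * Y) : mm_d (fst p) (fst q) <= prod_d X Y p q.
Proof. apply Rmax_l. Qed.

Lemma snd_lipschitz (X Y : mmspace) (p q : X * Y) : mm_d (snd p) (snd q) <= prod_d X Y p q.
Proof. apply Rmax_r. Qed.

Lemma borel_fst (X Y : mmspace) (A : X -> Prop) :
  Borel A -> borel (prod_d X Y) (fun p => A (fst p)).
Proof. apply (borel_preim_lipschitz (prod_d X Y) mm_d fst), fst_lipschitz. Qed.

Lemma borel_snd (X Y : mmspace) (B : Y -> Prop) :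
  Borel B -> borel (prod_d X Y) (fun p => B (snd p)).
Proof. apply (borel_preim_lipschitz (prod_d X Y) mm_d snd), snd_lipschitz. Qed.

Lemma splits_directed N a P : in_A1 N a ->
  (forall n, in_range N n -> lip_closed (P n)) ->
  (forall n, in_range N n ->
     forall X Y, P n X -> P n Y -> exists Z, P n Z /\ lip_prec X Z /\ lip_prec Y Z) ->
  forall X Y, splits N a P X -> splits N a P Y ->
    exists Z, splits N a P Z /\ lip_prec X Z /\ lip_prec Y Z.
Proof.
  intros HA Hdown Hdir X Y [nu [HP Hs]] [ka [HQ Ht]].
  assert (Hz : forall n, exists zeta : (X * Y -> Prop) -> R, in_range N n ->
    exists h : is_borel_prob (prod_d X Y) zeta, P n (prod_space X Y zeta h) /\
      (forall A, Borel A -> zeta (fun p => A (fst p)) = nu n A) /\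
      (forall B, Borel B -> zeta (fun p => B (snd p)) = ka n B)).
  { intros n; destruct (classic (in_range N n)) as [Hn|Hn]; [|exists (fun _ => 0); tauto].
    destruct (HP n Hn) as [h1 H1], (HQ n Hn) as [h2 H2].
    destruct (Hdir n Hn _ _ H1 H2) as [Z [HZ [[p [Hp Hpm]] [q [Hq Hqm]]]]].
    cbn in p, q, Hpm, Hqm.
    (* Mapping [Z] to [X * Y] puts the dominators for all [n] on one carrier, where they can be
       averaged; [g] is 1-Lipschitz because the metric is a maximum. *)
    pose (g := fun z : Z => (p z, q z)).
    assert (h : is_borel_prob (prod_d X Y) (fun B => mm_mu (fun z => B (g z)))).
    { apply is_borel_probE; split; [|apply mm_mu_True].
      apply (finmeas_push (@mm_d Z) _ g); [|apply mm_finmeas].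
      apply borel_preim_lipschitz; intros z z'; apply Rmax_lub; [apply Hp|apply Hq]. }
    exists (fun B => mm_mu (fun z => B (g z))); intros _; exists h; split; [|split].
    - apply (Hdown n Hn _ Z HZ); exists g; split; [|reflexivity].
      intros z z'; apply Rmax_lub; [apply Hp|apply Hq].
    - intros A HA'; rewrite Hpm by exact HA'; reflexivity.
    - intros B HB; rewrite Hqm by exact HB; reflexivity. }
  destruct (choice_fun _ Hz) as [zeta Hzeta]; clear Hz.
  assert (Hpr : forall n, in_range N n -> is_borel_prob (prod_d X Y) (zeta n)).
  { intros n Hn; destruct (Hzeta n Hn) as [h _]; exact h. }
  destruct (prob_series (prod_d X Y) N a zeta HA Hpr) as [m [Hm Hms]].
  exists (prod_space X Y m Hm); split; [|split].
  - exists zeta; split; [|exact Hms].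
    intros n Hn; destruct (Hzeta n Hn) as [h [Hh _]]; exists h; exact Hh.
  - exists fst; split; [intros p q; apply fst_lipschitz|]; intros A HA'.
    apply (sum_is_unique N (fun n => a n * nu n A)); [apply Hs, HA'|].
    apply sum_is_ext with (2 := Hms _ (borel_fst X Y A HA')).
    intros n Hn; destruct (Hzeta n Hn) as [h [_ [H1 H2]]]; rewrite H1 by exact HA'; reflexivity.
  - exists snd; split; [intros p q; apply snd_lipschitz|]; intros B HB.
    apply (sum_is_unique N (fun n => a n * ka n B)); [apply Ht, HB|].
    apply sum_is_ext with (2 := Hms _ (borel_snd X Y B HB)).
    intros n Hn; destruct (Hzeta n Hn) as [h [_ [H1 H2]]]; rewrite H2 by exact HB; reflexivity.
Qed.

(** * Finite sums and transport plans *)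

Lemma sum_ge0 f n : (forall i, (i <= n)%nat -> 0 <= f i) -> 0 <= sum_f_R0 f n.
Proof.
  intros H; induction n as [|n IH]; cbn [sum_f_R0]; [apply H; lia|].
  assert (0 <= f (S n)) by (apply H; lia).
  assert (0 <= sum_f_R0 f n) by (apply IH; intros; apply H; lia); lra.
Qed.

Lemma sum_term_le f n i : (forall i, (i <= n)%nat -> 0 <= f i) -> (i <= n)%nat ->
  f i <= sum_f_R0 f n.
Proof.
  intros H Hi; induction n as [|n IH]; cbn [sum_f_R0].
  - replace i with O by lia; lra.
  - assert (0 <= f (S n)) by (apply H; lia).
    assert (0 <= sum_f_R0 f n) by (apply sum_ge0; intros; apply H; lia).
    destruct (Nat.eq_dec i (S n)) as [->|]; [lra|].
    assert (f i <= sum_f_R0 f n); [|lra].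
    apply IH; [intros; apply H|]; lia.
Qed.

Lemma sum_scal c f n : sum_f_R0 (fun i => c * f i) n = c * sum_f_R0 f n.
Proof. induction n as [|n IH]; cbn [sum_f_R0]; [ring|rewrite IH; ring]. Qed.

Lemma sum_exchange (f : nat -> nat -> R) n m :
  sum_f_R0 (fun i => sum_f_R0 (fun j => f i j) m) n =
  sum_f_R0 (fun j => sum_f_R0 (fun i => f i j) n) m.
Proof.
  induction n as [|n IH]; cbn [sum_f_R0]; [reflexivity|].
  rewrite IH, <- sum_plus; reflexivity.
Qed.

Lemma sum2_le (f g : nat -> nat -> R) n m :
  (forall i j, (i <= n)%nat -> (j <= m)%nat -> f i j <= g i j) ->
  sum_f_R0 (fun i => sum_f_R0 (f i) m) n <= sum_f_R0 (fun i => sum_f_R0 (g i) m) n.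
Proof. intros H; apply sum_Rle; intros i Hi; apply sum_Rle; intros j Hj; apply H; assumption. Qed.

Lemma sum2_eq (f g : nat -> nat -> R) n m :
  (forall i j, (i <= n)%nat -> (j <= m)%nat -> f i j = g i j) ->
  sum_f_R0 (fun i => sum_f_R0 (f i) m) n = sum_f_R0 (fun i => sum_f_R0 (g i) m) n.
Proof. intros H; apply sum_eq; intros i Hi; apply sum_eq; intros j Hj; apply H; assumption. Qed.

(* Shrink row [i] by the factor [r i] so that it carries the mass
   [min (p i) (q i)], then spread the missing mass as a product. *)
Lemma transport_plan_adjust (I J : nat) (w : nat -> nat -> R) (q : nat -> R) :
  (forall i j, (i <= I)%nat -> (j <= J)%nat -> 0 <= w i j) ->
  (forall i, (i <= I)%nat -> 0 <= q i) ->
  sum_f_R0 (fun i => sum_f_R0 (w i) J) I = sum_f_R0 q I ->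
  exists W : nat -> nat -> R,
    (forall i j, (i <= I)%nat -> (j <= J)%nat -> 0 <= W i j) /\
    (forall i, (i <= I)%nat -> sum_f_R0 (W i) J = q i) /\
    (forall j, (j <= J)%nat ->
       sum_f_R0 (fun i => W i j) I = sum_f_R0 (fun i => w i j) I) /\
    (forall b : nat -> nat -> R, (forall i j, 0 <= b i j <= 1) ->
       sum_f_R0 (fun i => sum_f_R0 (fun j => b i j * W i j) J) I <=
       sum_f_R0 (fun i => sum_f_R0 (fun j => b i j * w i j) J) I +
       sum_f_R0 (fun i => Rabs (sum_f_R0 (w i) J - q i)) I).
Proof.
  intros Hw Hq Htot.
  pose (p i := sum_f_R0 (w i) J).
  pose (r i := Rmin (p i) (q i) / p i).
  assert (Hp : forall i, (i <= I)%nat -> 0 <= p i) by (intros i Hi; apply sum_ge0; auto).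
  assert (Hr : forall i, (i <= I)%nat -> 0 <= r i <= 1 /\ r i * p i = Rmin (p i) (q i)).
  { intros i Hi; specialize (Hp i Hi); specialize (Hq i Hi); unfold r.
    assert (h1 := Rmin_l (p i) (q i)); assert (h2 := Rmin_glb _ _ _ Hp Hq).
    destruct (Req_dec (p i) 0) as [h|h].
    - replace (Rmin (p i) (q i)) with 0 by lra; unfold Rdiv; rewrite Rmult_0_l; lra.
    - assert (0 < / p i) by (apply Rinv_0_lt_compat; lra).
      repeat split.
      + apply Rmult_le_pos; lra.
      + apply Rmult_le_reg_r with (p i); [lra|]; unfold Rdiv; rewrite Rmult_assoc, Rinv_l; lra.
      + field; exact h. }
  (* [u i] is the mass missing from row [i], [v j] the mass removed from column [j]; both total [t],
     because [w] and [q] have equal total mass. *)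
  pose (u i := q i - Rmin (p i) (q i)).
  pose (v j := sum_f_R0 (fun i => (1 - r i) * w i j) I).
  pose (t := sum_f_R0 u I).
  assert (Hu : forall i, (i <= I)%nat -> 0 <= u i).
  { intros i _; assert (h := Rmin_r (p i) (q i)); unfold u; lra. }
  assert (Hv : forall j, (j <= J)%nat -> 0 <= v j).
  { intros j Hj; apply sum_ge0; intros i Hi; apply Rmult_le_pos; [|apply Hw; assumption].
    destruct (Hr i Hi); lra. }
  assert (Ht : 0 <= t) by (apply sum_ge0, Hu).
  assert (Htv : sum_f_R0 v J = t).
  { unfold v; rewrite sum_exchange with (f := fun j i => (1 - r i) * w i j).
    transitivity (sum_f_R0 (fun i => p i - Rmin (p i) (q i)) I).
    - apply sum_eq; intros i Hi; rewrite sum_scal; destruct (Hr i Hi) as [_ <-]; unfold p; ring.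
    - unfold t, u; rewrite !minus_sum; unfold p; rewrite Htot; reflexivity. }
  (* For [t = 0] all [u i] and [v j] vanish, so the quotients by [t] are harmless. *)
  assert (Hdiv : forall x, 0 <= x <= t -> x * (t / t) = x).
  { intros x Hx; destruct (Req_dec t 0) as [h|h]; [replace x with 0 by lra; ring|field; exact h]. }
  exists (fun i j => r i * w i j + u i * v j / t); split; [|split; [|split]].
  - intros i j Hi Hj; destruct (Hr i Hi) as [[h0 _] _]; specialize (Hw i j Hi Hj).
    specialize (Hu i Hi); specialize (Hv j Hj).
    apply Rplus_le_le_0_compat; [apply Rmult_le_pos; assumption|].
    destruct (Req_dec t 0) as [h|h].
    + assert (h' := sum_term_le u I i ltac:(intros; unfold u; assert (h' := Rmin_r (p i0) (q i0)); lra) Hi).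
      fold t in h'; replace (u i) with 0 by lra; unfold Rdiv; rewrite !Rmult_0_l; lra.
    + apply Rmult_le_pos; [apply Rmult_le_pos; assumption|left; apply Rinv_0_lt_compat; lra].
  - intros i Hi; rewrite sum_plus, sum_scal.
    rewrite (sum_eq (fun j => u i * v j / t) (fun j => (u i / t) * v j)) by (intros; unfold Rdiv; ring).
    rewrite sum_scal, Htv; fold (p i); destruct (Hr i Hi) as [_ ->].
    replace (u i / t * t) with (u i * (t / t)) by (unfold Rdiv; ring).
    rewrite Hdiv; [unfold u; ring|].
    split; [apply Hu, Hi|apply sum_term_le; assumption].
  - intros j Hj; rewrite sum_plus.
    rewrite (sum_eq (fun i => u i * v j / t) (fun i => (v j / t) * u i)) by (intros; unfold Rdiv; ring).
    rewrite sum_scal; fold t.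
    replace (v j / t * t) with (v j * (t / t)) by (unfold Rdiv; ring).
    rewrite Hdiv.
    + unfold v; rewrite <- sum_plus; apply sum_eq; intros; ring.
    + split; [apply Hv, Hj|rewrite <- Htv; apply sum_term_le; assumption].
  - intros b Hb.
    apply Rle_trans with (sum_f_R0 (fun i => sum_f_R0 (fun j => b i j * w i j + u i * v j / t) J) I).
    + apply sum2_le; intros i j Hi Hj; destruct (Hr i Hi) as [[h0 h1] _].
      specialize (Hw i j Hi Hj); specialize (Hb i j); specialize (Hu i Hi); specialize (Hv j Hj).
      assert (0 <= u i * v j / t).
      { destruct (Req_dec t 0) as [h|h].
        - assert (h' := sum_term_le u I i ltac:(intros; unfold u; assert (h' := Rmin_r (p i0) (q i0)); lra) Hi).
          fold t in h'; replace (u i) with 0 by lra; unfold Rdiv; rewrite !Rmult_0_l; lra.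
        - apply Rmult_le_pos; [apply Rmult_le_pos; assumption|left; apply Rinv_0_lt_compat; lra]. }
      assert (r i * w i j <= w i j) by nra.
      rewrite Rmult_plus_distr_l; apply Rplus_le_compat; [|nra].
      apply Rmult_le_compat_l; lra.
    + rewrite (sum_eq _ (fun i => sum_f_R0 (fun j => b i j * w i j) J + sum_f_R0 (fun j => u i * v j / t) J))
        by (intros; apply sum_plus).
      rewrite sum_plus; apply Rplus_le_compat_l.
      (* The added mass is [t], the sum of the positive parts of [q i - p i], hence at most the sum
         of the absolute values. *)
      apply Rle_trans with (sum_f_R0 u I).
      * apply sum_Rle; intros i Hi.
        rewrite (sum_eq (fun j => u i * v j / t) (fun j => (u i / t) * v j)) by (intros; unfold Rdiv; ring).
        rewrite sum_scal, Htv; replace (u i / t * t) with (u i * (t / t)) by (unfold Rdiv; ring).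
        rewrite Hdiv; [lra|split; [apply Hu, Hi|apply sum_term_le; assumption]].
      * apply sum_Rle; intros i Hi; unfold u; fold (p i).
        unfold Rmin; destruct (Rle_dec (p i) (q i)) as [h|h].
        -- rewrite Rabs_minus_sym; apply Rle_abs.
        -- rewrite Rminus_diag; apply Rabs_pos.
Qed.

(** * Finite labellings *)

Definition ind (Q : Prop) : R := if excluded_middle_informative Q then 1 else 0.

Lemma ind_bound Q : 0 <= ind Q <= 1.
Proof. unfold ind; destruct excluded_middle_informative; lra. Qed.

(** A finite Borel partition, given by its label function. In the box estimates the last label [I]
    marks a remainder cell, small in mass but without a diameter bound. *)
Definition labelling {X : Type} (d : X -> X -> R) (c : X -> nat) (I : nat) : Prop :=
  (forall x, (c x <= I)%nat) /\ forall i, borel d (fun x => c x = i).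

Lemma charge_labelling {X : Type} (d : X -> X -> R) m c I B :
  charge d m -> labelling d c I -> borel d B ->
  m B = sum_f_R0 (fun i => m (fun x => B x /\ c x = i)) I.
Proof.
  intros Hm [Hc Hb] HB.
  rewrite <- (charge_partial_union d m (fun i x => B x /\ c x = i)); trivial.
  - f_equal; apply pred_ext; intros x; split.
    + intros H; exists (c x); auto.
    + intros [k [_ [H _]]]; exact H.
  - intros k; apply borel_and; [exact HB|apply Hb].
  - intros i j x Hij [_ H1] [_ H2]; congruence.
Qed.

Lemma charge_labelling_total {X : Type} (d : X -> X -> R) m c I :
  charge d m -> labelling d c I ->
  sum_f_R0 (fun i => m (fun x => c x = i)) I = m (fun _ => True).
Proof.
  intros Hm Hc; rewrite (charge_labelling d m c I _ Hm Hc (borel_True d)).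
  apply sum_eq; intros i _; f_equal; apply pred_ext; tauto.
Qed.

(** Balls of radius [dl / 2] around the dense points, made disjoint by the first index, exhaust the
    space. A tail of cells of total mass below [e] is merged into the last label [S n]. *)
Lemma small_labelling (X : mmspace) dl e : 0 < dl -> 0 < e -> exists c I,
  labelling (@mm_d X) c I /\
  (forall x y, c x = c y -> (c x < I)%nat -> mm_d x y <= dl) /\
  mm_mu (fun x => c x = I) <= e.
Proof.
  intros Hdl He; destruct (mm_separable X) as [s Hs].
  pose (B i (x : X) := mm_d (s i) x < dl / 2).
  pose (A i x := B i x /\ forall k, (k < i)%nat -> ~ B k x).
  assert (bA : forall i, Borel (A i)).
  { intros i; apply borel_and; [apply borel_ball|].
    apply (borel_forall_lt mm_d (fun k x => ~ B k x)); intros k; apply borel_not, borel_ball. }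
  assert (dA : forall i j x, i <> j -> A i x -> A j x -> False).
  { intros i j x Hij [H1 H2] [H3 H4].
    destruct (Nat.lt_total i j) as [h|[h|h]]; [exact (H4 _ h H1)|lia|exact (H2 _ h H3)]. }
  destruct (finmeas_tail mm_d mm_mu A (mm_finmeas X) bA dA e He) as [n Hn].
  specialize (Hn n (le_n n)).
  assert (Hex : forall x, exists i, ((i <= n)%nat /\ A i x) \/
     (i = S n /\ exists k, (n < k)%nat /\ A k x)).
  { intros x; destruct (first_index (fun i => B i x)) as [i Hi].
    - destruct (Hs x (dl / 2)) as [i Hi]; [lra|]; exists i; unfold B; rewrite metric_sym; exact Hi.
    - destruct (Compare_dec.le_lt_dec i n) as [h|h].
      + exists i; left; split; [exact h|exact Hi].
      + exists (S n); right; split; [reflexivity|]; exists i; split; [exact h|exact Hi]. }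
  destruct (choice_fun _ Hex) as [c Hc]; clear Hex.
  assert (cE : forall i x, (i <= n)%nat -> (c x = i <-> A i x)).
  { intros i x Hi; destruct (Hc x) as [[h1 h2]|[h1 [k [h2 h3]]]]; split.
    - intros <-; exact h2.
    - intros H; destruct (Nat.eq_dec (c x) i) as [|h]; trivial; destruct (dA _ _ x h h2 H).
    - lia.
    - intros H; destruct (dA i k x ltac:(lia) H h3). }
  assert (cL : forall x, c x = S n <-> exists k, (n < k)%nat /\ A k x).
  { intros x; destruct (Hc x) as [[h1 h2]|[h1 h2]]; split; trivial; [lia|].
    intros [k [h3 h4]]; destruct (dA (c x) k x ltac:(lia) h2 h4). }
  exists c, (S n); split; [|split].
  - split.
    + intros x; destruct (Hc x) as [[h _]|[h _]]; lia.
    + intros i; destruct (Compare_dec.le_lt_dec i n) as [h|h].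
      * rewrite (pred_ext (fun x => c x = i) (A i)); [apply bA|]; intros x; apply cE, h.
      * destruct (Nat.eq_dec i (S n)) as [->|h'].
        -- rewrite (pred_ext _ _ cL); apply borel_ex; intros k.
           apply borel_and; [apply borel_const|apply bA].
        -- rewrite (pred_ext (fun x => c x = i) (fun _ => False)); [apply borel_False|].
           intros x; split; [|tauto]; destruct (Hc x) as [[h1 _]|[h1 _]]; lia.
  - intros x y Hxy Hx; assert (hx := proj1 (cE (c x) x ltac:(lia)) eq_refl).
    assert (hy := proj1 (cE (c x) y ltac:(lia)) (eq_sym Hxy)).
    destruct hx as [hx _], hy as [hy _]; unfold B in *.
    assert (h := metric_tri X x (s (c x)) y); rewrite (metric_sym X x (s (c x))) in h; lra.
  - rewrite (pred_ext _ _ cL); unfold Rdist in Hn; rewrite Rminus_0_r in Hn.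
    apply Rabs_def2 in Hn; lra.
Qed.

Section LabelledProduct.
Context {X Y : mmspace} {c : X -> nat} {I : nat} {c' : Y -> nat} {J : nat}.
Hypothesis (Hc : labelling (@mm_d X) c I) (Hc' : labelling (@mm_d Y) c' J).

Lemma labelling_fst : labelling (prod_d X Y) (fun p => c (fst p)) I.
Proof.
  split; [intros p; apply Hc|]; intros i.
  apply (borel_fst X Y (fun x => c x = i)), Hc.
Qed.

Lemma labelling_snd : labelling (prod_d X Y) (fun p => c' (snd p)) J.
Proof.
  split; [intros p; apply Hc'|]; intros i.
  apply (borel_snd X Y (fun x => c' x = i)), Hc'.
Qed.

Lemma borel_cell i j : borel (prod_d X Y) (fun p => c (fst p) = i /\ c' (snd p) = j).
Proof. apply borel_and; [apply labelling_fst|apply labelling_snd]. Qed.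

Lemma borel_label_rel (Q : nat -> nat -> Prop) :
  borel (prod_d X Y) (fun p => Q (c (fst p)) (c' (snd p))).
Proof.
  rewrite (pred_ext _ (fun p => exists i j, Q i j /\ c (fst p) = i /\ c' (snd p) = j)).
  - apply borel_ex; intros i; apply borel_ex; intros j.
    apply borel_and; [apply borel_const|apply borel_cell].
  - intros p; split; [intros H; exists (c (fst p)), (c' (snd p)); auto|].
    intros [i [j [H [<- <-]]]]; exact H.
Qed.

Lemma charge_cell_rel m (Q : nat -> nat -> Prop) i j : charge (prod_d X Y) m ->
  m (fun p => Q (c (fst p)) (c' (snd p)) /\ c (fst p) = i /\ c' (snd p) = j) =
  ind (Q i j) * m (fun p => c (fst p) = i /\ c' (snd p) = j).
Proof.
  intros Hm; unfold ind; destruct excluded_middle_informative as [h|h].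
  - rewrite Rmult_1_l; f_equal; apply pred_ext; intros p; split; [tauto|].
    intros [<- <-]; auto.
  - rewrite Rmult_0_l, <- (charge_False _ m Hm); f_equal; apply pred_ext; intros p.
    split; [|tauto]; intros [H [<- <-]]; exact (h H).
Qed.

Lemma charge_cells m B : charge (prod_d X Y) m -> borel (prod_d X Y) B ->
  m B = sum_f_R0 (fun i => sum_f_R0 (fun j =>
    m (fun p => B p /\ c (fst p) = i /\ c' (snd p) = j)) J) I.
Proof.
  intros Hm HB; rewrite (charge_labelling _ m _ I B Hm labelling_fst HB).
  apply sum_eq; intros i _.
  rewrite (charge_labelling _ m _ J _ Hm labelling_snd)
    by (apply borel_and; [exact HB|apply labelling_fst]).
  apply sum_eq; intros j _; f_equal; apply pred_ext; tauto.
Qed.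

Lemma charge_label_rel m (Q : nat -> nat -> Prop) : charge (prod_d X Y) m ->
  m (fun p => Q (c (fst p)) (c' (snd p))) =
  sum_f_R0 (fun i => sum_f_R0 (fun j =>
    ind (Q i j) * m (fun p => c (fst p) = i /\ c' (snd p) = j)) J) I.
Proof.
  intros Hm; rewrite charge_cells by (trivial; apply borel_label_rel).
  apply sum2_eq; intros i j _ _; apply charge_cell_rel, Hm.
Qed.

(* Inside each cell the product measure is rescaled to the prescribed mass. *)
Lemma coupling_of_transport_plan (W : nat -> nat -> R) :
  (forall i j, (i <= I)%nat -> (j <= J)%nat -> 0 <= W i j) ->
  (forall i, (i <= I)%nat -> sum_f_R0 (W i) J = mm_mu (fun x => c x = i)) ->
  (forall j, (j <= J)%nat -> sum_f_R0 (fun i => W i j) I = mm_mu (fun y => c' y = j)) ->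
  exists pi, coupling X Y pi /\
    forall Q : nat -> nat -> Prop, pi (fun p => Q (c (fst p)) (c' (snd p))) =
      sum_f_R0 (fun i => sum_f_R0 (fun j => ind (Q i j) * W i j) J) I.
Proof.
  intros HW Hrow Hcol.
  destruct (MathCompBridge.product_prob X Y) as [tau [Htau Hrect]].
  assert (Ctau := prob_charge _ _ Htau).
  pose (al i := mm_mu (fun x => c x = i)); pose (be j := mm_mu (fun y => c' y = j)).
  change (forall i, (i <= I)%nat -> sum_f_R0 (W i) J = al i) in Hrow.
  change (forall j, (j <= J)%nat -> sum_f_R0 (fun i => W i j) I = be j) in Hcol.
  assert (al0 : forall i, 0 <= al i) by (intros i; apply mm_finmeas, Hc).
  assert (be0 : forall j, 0 <= be j) by (intros j; apply mm_finmeas, Hc').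
  assert (Wal : forall i j, (i <= I)%nat -> (j <= J)%nat -> W i j <= al i).
  { intros i j Hi Hj; rewrite <- (Hrow i Hi).
    apply (sum_term_le (W i) J j); [intros; apply HW|]; trivial. }
  assert (Wbe : forall i j, (i <= I)%nat -> (j <= J)%nat -> W i j <= be j).
  { intros i j Hi Hj; rewrite <- (Hcol j Hj).
    apply (sum_term_le (fun i => W i j) I i); [intros; apply HW|]; trivial. }
  (* This is the density with respect to the product measure. A null row or column forces
     [W i j = 0], which covers zero denominators. *)
  pose (g i j := W i j / (al i * be j)).
  assert (gW : forall i j, (i <= I)%nat -> (j <= J)%nat -> g i j * (al i * be j) = W i j).
  { intros i j Hi Hj; unfold g.
    specialize (HW i j Hi Hj); specialize (Wal i j Hi Hj); specialize (Wbe i j Hi Hj).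
    destruct (Req_dec (al i) 0) as [h|h]; [replace (W i j) with 0 by lra; unfold Rdiv; ring|].
    destruct (Req_dec (be j) 0) as [h'|h']; [replace (W i j) with 0 by lra; unfold Rdiv; ring|].
    field; tauto. }
  assert (g0 : forall i j, (i <= I)%nat -> (j <= J)%nat -> 0 <= g i j).
  { intros i j Hi Hj; unfold g.
    specialize (HW i j Hi Hj); specialize (Wal i j Hi Hj); specialize (Wbe i j Hi Hj).
    destruct (Req_dec (W i j) 0) as [->|h]; [unfold Rdiv; lra|].
    apply Rmult_le_pos; [exact HW|left; apply Rinv_0_lt_compat, Rmult_lt_0_compat; lra]. }
  pose (pi D := sum_f_R0 (fun i => sum_f_R0 (fun j =>
     g i j * tau (fun p => D p /\ c (fst p) = i /\ c' (snd p) = j)) J) I).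
  assert (Hpi : finmeas (prod_d X Y) pi).
  { apply (finmeas_sum _ (fun i D => sum_f_R0 (fun j =>
      g i j * tau (fun p => D p /\ c (fst p) = i /\ c' (snd p) = j)) J)); intros i Hi.
    apply (finmeas_sum _ (fun j D =>
      g i j * tau (fun p => D p /\ c (fst p) = i /\ c' (snd p) = j))); intros j Hj.
    apply finmeas_scal; [apply g0; assumption|].
    apply finmeas_restrict; [apply is_borel_probE, Htau|apply borel_cell]. }
  (* Splitting [x] in the proportions [f k / z] loses nothing; if [z = 0] then [x = 0] too. *)
  assert (scale : forall x z f n, 0 <= x <= z -> sum_f_R0 f n = z ->
    (forall k, (k <= n)%nat -> 0 <= f k) -> sum_f_R0 (fun k => f k / z * x) n = x).
  { intros x z f n Hx Hz Hf.
    rewrite (sum_eq (fun k => f k / z * x) (fun k => (x / z) * f k)) by (intros; unfold Rdiv; ring).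
    rewrite sum_scal, Hz; destruct (Req_dec z 0) as [h|h]; [|field; exact h].
    replace x with 0 by lra; unfold Rdiv; ring. }
  assert (m1 : forall A, Borel A -> pi (fun p => A (fst p)) = mm_mu A).
  { intros A HA; unfold pi.
    rewrite (charge_labelling mm_d mm_mu c I A (mm_charge X) Hc HA).
    apply sum_eq; intros i Hi.
    set (x := mm_mu (fun z => A z /\ c z = i)).
    assert (Hx : 0 <= x <= al i).
    { split; [apply mm_finmeas|apply (charge_mono mm_d mm_mu (fun z => A z /\ c z = i) (fun z => c z = i));
        [apply mm_charge| |apply Hc|tauto]];
        (apply borel_and; [exact HA|apply Hc]). }
    rewrite <- (scale x (al i) (W i) J Hx (Hrow i Hi)) at 1 by (intros; apply HW; assumption).
    apply sum_eq; intros j Hj.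
    rewrite (pred_ext _ (fun p => (A (fst p) /\ c (fst p) = i) /\ c' (snd p) = j)) by tauto.
    rewrite (Hrect (fun z => A z /\ c z = i) (fun y => c' y = j))
      by (try apply borel_and; trivial; apply Hc || apply Hc').
    fold x (be j); rewrite <- gW by assumption.
    destruct (Req_dec (al i) 0) as [h|h]; [replace x with 0 by lra; ring|field; exact h]. }
  assert (m2 : forall B, Borel B -> pi (fun p => B (snd p)) = mm_mu B).
  { intros B HB; unfold pi; rewrite sum_exchange with
      (f := fun i j => g i j * tau (fun p => B (snd p) /\ c (fst p) = i /\ c' (snd p) = j)).
    rewrite (charge_labelling mm_d mm_mu c' J B (mm_charge Y) Hc' HB).
    apply sum_eq; intros j Hj.
    set (x := mm_mu (fun z => B z /\ c' z = j)).
    assert (Hx : 0 <= x <= be j).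
    { split; [apply mm_finmeas|apply (charge_mono mm_d mm_mu (fun z => B z /\ c' z = j) (fun z => c' z = j));
        [apply mm_charge| |apply Hc'|tauto]];
        (apply borel_and; [exact HB|apply Hc']). }
    rewrite <- (scale x (be j) (fun i => W i j) I Hx (Hcol j Hj)) at 1
      by (intros; apply HW; assumption).
    apply sum_eq; intros i Hi.
    rewrite (pred_ext _ (fun p => c (fst p) = i /\ (B (snd p) /\ c' (snd p) = j))) by tauto.
    rewrite (Hrect (fun z => c z = i) (fun y => B y /\ c' y = j))
      by (try apply borel_and; trivial; apply Hc || apply Hc').
    fold x (al i); rewrite <- gW by assumption.
    destruct (Req_dec (be j) 0) as [h|h]; [replace x with 0 by lra; ring|field; exact h]. }
  exists pi; split; [split; [|split; assumption]|].
  - apply is_borel_probE; split; [exact Hpi|].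
    rewrite (m1 (fun _ => True)) by apply borel_True; apply mm_mu_True.
  - intros Q; apply sum2_eq; intros i j Hi Hj.
    rewrite charge_cell_rel by exact Ctau.
    rewrite (Hrect (fun x => c x = i) (fun y => c' y = j)) by (apply Hc || apply Hc').
    rewrite <- gW by assumption; unfold al, be; ring.
Qed.

End LabelledProduct.

(** * Transferring a summand along a coupling *)

(* The density of [nu] with respect to [mm_mu] is replaced by its average over
   each cell of [c'], multiplied into [pi], and projected to [X]. *)
Definition transfer {X Y : mmspace} (pi : (X * Y -> Prop) -> R) (c' : Y -> nat) (J : nat)
    (nu : (Y -> Prop) -> R) (B : X -> Prop) : R :=
  sum_f_R0 (fun j => nu (fun y => c' y = j) / mm_mu (fun y => c' y = j) *
    pi (fun p => B (fst p) /\ c' (snd p) = j)) J.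

(** With [m] the mass of a cell and [x] its mass for a summand, the quotient is the averaged
    density. Domination bounds it by [/ al] and forces [x = 0] when [m = 0]. *)
Lemma dominated_ratio al x m : 0 < al -> 0 <= x -> al * x <= m ->
  0 <= x / m <= / al /\ x / m * m = x.
Proof.
  intros Hal Hx Hm; destruct (Req_dec m 0) as [h|h].
  - replace x with 0 by nra; unfold Rdiv; rewrite !Rmult_0_l.
    assert (0 < / al) by (apply Rinv_0_lt_compat, Hal); lra.
  - assert (0 < m) by nra; assert (0 < / m) by (apply Rinv_0_lt_compat; lra).
    repeat split.
    + apply Rmult_le_pos; lra.
    + apply Rmult_le_reg_l with (al * m); [nra|].
      replace (al * m * (x / m)) with (al * x) by (field; lra).
      replace (al * m * / al) with m by (field; lra); exact Hm.
    + field; exact h.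
Qed.

Section Transfer.
Context {X Y : mmspace} {pi : (X * Y -> Prop) -> R} {c' : Y -> nat} {J : nat}.
Hypotheses (Hpi : coupling X Y pi) (Hc' : labelling (@mm_d Y) c' J).

Let Cpi : charge (prod_d X Y) pi.
Proof. apply prob_charge, Hpi. Qed.

Let borel_slice (B : X -> Prop) j : Borel B -> borel (prod_d X Y) (fun p => B (fst p) /\ c' (snd p) = j).
Proof. intros HB; apply borel_and; [apply borel_fst, HB|apply (labelling_snd Hc')]. Qed.

(** On a cell of positive mass the averaged densities, weighted by [a n], add up to 1; a null cell
    carries no mass of [pi] either, since [mm_mu] is the second marginal. *)
Lemma transfer_sum N a nu : in_A1 N a ->
  (forall n, in_range N n -> is_borel_prob (@mm_d Y) (nu n)) ->
  (forall B, Borel B -> sum_is N (fun n => a n * nu n B) (mm_mu B)) ->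
  forall B, Borel B -> sum_is N (fun n => a n * transfer pi c' J (nu n) B) (mm_mu B).
Proof.
  intros HA Hnu Hs B HB; destruct Hpi as [_ [Hp1 Hp2]].
  rewrite <- Hp1 by exact HB.
  rewrite (charge_labelling _ pi _ J _ Cpi (labelling_snd Hc')) by apply borel_fst, HB.
  apply sum_is_ext with (fun n => sum_f_R0 (fun j => pi (fun p => B (fst p) /\ c' (snd p) = j) /
     mm_mu (fun y => c' y = j) * (a n * nu n (fun y => c' y = j))) J).
  - intros n Hn; unfold transfer; rewrite <- sum_scal; apply sum_eq; intros j _; unfold Rdiv; ring.
  - apply sum_is_fin_sum with (u := fun j n => pi (fun p => B (fst p) /\ c' (snd p) = j) /
      mm_mu (fun y => c' y = j) * (a n * nu n (fun y => c' y = j))).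
    intros j Hj; assert (h := Hs _ (proj2 Hc' j)).
    apply (sum_is_scal N (pi (fun p => B (fst p) /\ c' (snd p) = j) / mm_mu (fun y => c' y = j))) in h.
    destruct (dominated_ratio 1 (pi (fun p => B (fst p) /\ c' (snd p) = j)) (mm_mu (fun y => c' y = j)))
      as [_ h']; [lra|apply Cpi, borel_slice, HB| |rewrite h' in h; exact h].
    rewrite Rmult_1_l, <- (Hp2 (fun y => c' y = j)) by apply Hc'.
    apply (charge_mono (prod_d X Y)); [exact Cpi|apply borel_slice, HB| |tauto].
    apply (labelling_snd Hc').
Qed.

Context {nu : (Y -> Prop) -> R} {al : R}.
Hypotheses (Hnu : is_borel_prob (@mm_d Y) nu) (Hal : 0 < al)
  (Hdom : forall B, Borel B -> al * nu B <= mm_mu B).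

Let ratio j : 0 <= nu (fun y => c' y = j) / mm_mu (fun y => c' y = j) <= / al /\
  nu (fun y => c' y = j) / mm_mu (fun y => c' y = j) * mm_mu (fun y => c' y = j) =
  nu (fun y => c' y = j).
Proof.
  apply dominated_ratio; [exact Hal|apply Hnu, Hc'|apply Hdom, Hc'].
Qed.

Lemma transfer_charge : charge (@mm_d X) (transfer pi c' J nu).
Proof.
  split.
  - intros A HA; apply sum_ge0; intros j _; apply Rmult_le_pos; [apply ratio|].
    apply Cpi, borel_slice, HA.
  - intros A B HA HB Hd; unfold transfer; rewrite <- sum_plus; apply sum_eq; intros j _.
    rewrite <- Rmult_plus_distr_l, <- (proj2 Cpi).
    + f_equal; f_equal; apply pred_ext; tauto.
    + apply borel_slice, HA.
    + apply borel_slice, HB.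
    + intros p [H1 _] [H2 _]; exact (Hd _ H1 H2).
Qed.

Lemma transfer_True : transfer pi c' J nu (fun _ => True) = 1.
Proof.
  rewrite <- (proj1 (proj2 Hnu)), <- (charge_labelling_total mm_d nu c' J)
    by (trivial; apply prob_charge, Hnu).
  apply sum_eq; intros j _.
  rewrite <- (proj2 (ratio j)) at 2; f_equal.
  rewrite <- (proj2 (proj2 Hpi) (fun y => c' y = j)) by apply Hc'.
  f_equal; apply pred_ext; tauto.
Qed.

(** The plan [w] between cells has column sums given by [nu] and row sums given by the transferred
    measure. Adjusting its rows yields a coupling with [eta], at an extra cost equal to the last
    sum. That coupling is computed on unions of cells, so [S] is replaced by the cells it meets and
    the cell diameters enter the distortion. *)
Lemma transfer_box S c I e dl dl' eta (h : is_borel_prob (@mm_d X) eta) eps :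
  borel (prod_d X Y) S -> dis_le X Y S e -> 1 - pi S <= e ->
  labelling (@mm_d X) c I ->
  (forall x y, c x = c y -> (c x < I)%nat -> mm_d x y <= dl) ->
  (forall x y, c' x = c' y -> (c' x < J)%nat -> mm_d x y <= dl') ->
  e + 2 * dl + 2 * dl' < eps ->
  / al * (e + mm_mu (fun x => c x = I) + mm_mu (fun y => c' y = J)) +
    sum_f_R0 (fun i => Rabs (transfer pi c' J nu (fun x => c x = i) - eta (fun x => c x = i))) I
    < eps ->
  box_lt (with_measure X eta h) (with_measure Y nu Hnu) eps.
Proof.
  intros HS Hdis HpS Hc Hdl Hdl' E1 E2.
  pose (w i j := nu (fun y => c' y = j) / mm_mu (fun y => c' y = j) *
    pi (fun p => c (fst p) = i /\ c' (snd p) = j)).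
  assert (w0 : forall i j, 0 <= w i j).
  { intros i j; apply Rmult_le_pos; [apply ratio|apply Cpi, (borel_cell Hc Hc')]. }
  assert (wcol : forall j, (j <= J)%nat -> sum_f_R0 (fun i => w i j) I = nu (fun y => c' y = j)).
  { intros j Hj; unfold w; rewrite sum_scal; rewrite <- (proj2 (ratio j)) at 2; f_equal.
    rewrite <- (proj2 (proj2 Hpi) (fun y => c' y = j)) by apply Hc'.
    rewrite (charge_labelling _ pi _ I _ Cpi (labelling_fst Hc)) by apply (labelling_snd Hc').
    apply sum_eq; intros i _; f_equal; apply pred_ext; tauto. }
  destruct (transport_plan_adjust I J w (fun i => eta (fun x => c x = i))) as [W [W0 [Wrow [Wcol Wb]]]].
  - intros; apply w0.
  - intros i _; apply h, Hc.
  - rewrite sum_exchange with (f := w), (charge_labelling_total mm_d)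
      by (trivial; apply prob_charge, h).
    rewrite (proj1 (proj2 h)), <- (proj1 (proj2 Hnu)).
    rewrite <- (charge_labelling_total mm_d nu c' J) by (trivial; apply prob_charge, Hnu).
    apply sum_eq, wcol.
  - assert (Hplan : exists sg : (X * Y -> Prop) -> R,
      coupling (with_measure X eta h) (with_measure Y nu Hnu) sg /\
      forall Q : nat -> nat -> Prop, sg (fun p => Q (c (fst p)) (c' (snd p))) =
        sum_f_R0 (fun i => sum_f_R0 (fun j => ind (Q i j) * W i j) J) I).
    { apply (coupling_of_transport_plan (X := with_measure X eta h) (Y := with_measure Y nu Hnu)
        Hc Hc' W W0 Wrow).
      intros j Hj; rewrite Wcol by exact Hj; apply wcol, Hj. }
    destruct Hplan as [sg [Hsg HQ]].
    (* Remainder cells are discarded because their diameters are uncontrolled. *)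
    pose (Q i j := (i < I)%nat /\ (j < J)%nat /\ exists p, S p /\ c (fst p) = i /\ c' (snd p) = j).
    assert (Csg : charge (prod_d X Y) sg) by (apply prob_charge, Hsg).
    exists sg, (fun p => Q (c (fst p)) (c' (snd p))),
      (Rmax (e + 2 * dl + 2 * dl') (/ al * (e + mm_mu (fun x => c x = I) + mm_mu (fun y => c' y = J)) +
        sum_f_R0 (fun i => Rabs (transfer pi c' J nu (fun x => c x = i) - eta (fun x => c x = i))) I)).
    split; [exact Hsg|split; [apply (borel_label_rel Hc Hc')|split; [apply Rmax_lub_lt; assumption|split]]].
    (* Each point of a selected cell is compared with a point of [S] in that cell; the two endpoints
       in each space give [2 * dl] and [2 * dl']. *)
    + intros [x y] [x' y'] [i1 [j1 [[x0 y0] [s1 [cx cy]]]]] [i2 [j2 [[x1 y1] [s2 [cx' cy']]]]].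
      cbn [fst snd] in *; eapply Rle_trans; [|apply Rmax_l].
      assert (D := Hdis _ _ s1 s2); cbn [fst snd] in D.
      assert (a1 := Hdl x x0 (eq_sym cx) i1); assert (a2 := Hdl x' x1 (eq_sym cx') i2).
      assert (b1 := Hdl' y y0 (eq_sym cy) j1); assert (b2 := Hdl' y' y1 (eq_sym cy') j2).
      cbn.
      assert (t1 := metric_tri X x x0 x'); assert (t2 := metric_tri X x0 x1 x').
      assert (t3 := metric_tri X x0 x x1); assert (t4 := metric_tri X x x' x1).
      assert (u1 := metric_tri Y y y0 y'); assert (u2 := metric_tri Y y0 y1 y').
      assert (u3 := metric_tri Y y0 y y1); assert (u4 := metric_tri Y y y' y1).
      rewrite (metric_sym X x1 x') in t2; rewrite (metric_sym X x0 x) in t3.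
      rewrite (metric_sym Y y1 y') in u2; rewrite (metric_sym Y y0 y) in u3.
      apply Rabs_le; assert (D1 := Rle_abs (mm_d x0 x1 - mm_d y0 y1)).
      assert (D2 := Rle_abs (- (mm_d x0 x1 - mm_d y0 y1))); rewrite Rabs_Ropp in D2; lra.
    + eapply Rle_trans; [|apply Rmax_r].
      assert (E : sg (fun p => ~ Q (c (fst p)) (c' (snd p))) = 1 - sg (fun p => Q (c (fst p)) (c' (snd p)))).
      { rewrite (charge_not (prod_d X Y) sg _ Csg (borel_label_rel Hc Hc' Q)).
        f_equal; apply (proj1 Hsg). }
      apply Rle_trans with (1 := Req_le _ _ (eq_sym E)).
      rewrite (HQ (fun i j => ~ Q i j)).
      eapply Rle_trans; [apply Wb; intros; apply ind_bound|].
      apply Rplus_le_compat; [|apply Req_le; reflexivity].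
      (* Densities are at most [/ al], so on each cell [w] is at most [/ al] times [pi]. *)
      apply Rle_trans with (/ al * pi (fun p => ~ Q (c (fst p)) (c' (snd p)))).
      * rewrite (charge_label_rel Hc Hc' pi (fun i j => ~ Q i j) Cpi), <- sum_scal.
        rewrite (sum_eq (fun i => / al * _) (fun i => sum_f_R0 (fun j => / al * (ind (~ Q i j) *
          pi (fun p => c (fst p) = i /\ c' (snd p) = j))) J)) by (intros; symmetry; apply sum_scal).
        apply sum2_le; intros i j _ _; unfold w.
        assert (h1 := ind_bound (~ Q i j)); destruct (ratio j) as [h2 _].
        assert (h3 := proj1 Cpi _ (borel_cell Hc Hc' i j)).
        revert h1 h2 h3; generalize (ind (~ Q i j)) (nu (fun y => c' y = j) / mm_mu (fun y => c' y = j))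
          (pi (fun p => c (fst p) = i /\ c' (snd p) = j)); intros b r z h1 h2 h3.
        assert (0 <= b * z) by nra.
        replace (b * (r * z)) with (r * (b * z)) by ring.
        apply Rmult_le_compat_r; lra.
      * assert (0 < / al) by (apply Rinv_0_lt_compat, Hal).
        apply Rmult_le_compat_l; [lra|].
        (* A point outside the selected cells is outside [S] or has a remainder label in one of the
           spaces. *)
        apply Rle_trans with (pi (fun p => (~ S p \/ c (fst p) = I) \/ c' (snd p) = J)).
        { assert (b1 := proj2 (labelling_fst (Y := Y) Hc) I).
          assert (b2 := proj2 (labelling_snd (X := X) Hc') J).
          apply (charge_mono (prod_d X Y)); [exact Cpi|apply (borel_label_rel Hc Hc' (fun i j => ~ Q i j))| |].
          - repeat apply borel_or; trivial; apply borel_not, HS.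
          - intros p Hp; apply NNPP; intros Hn; apply Hp; unfold Q.
            assert (l1 := proj1 Hc (fst p)); assert (l2 := proj1 Hc' (snd p)).
            split; [|split].
            + assert (c (fst p) <> I) by tauto; lia.
            + assert (c' (snd p) <> J) by tauto; lia.
            + exists p; split; [apply NNPP; tauto|split; reflexivity]. }
        assert (b1 := proj2 (labelling_fst (Y := Y) Hc) I).
        assert (b2 := proj2 (labelling_snd (X := X) Hc') J).
        assert (b3 : borel (prod_d X Y) (fun p => ~ S p)) by apply borel_not, HS.
        assert (o1 := charge_or _ pi _ _ Cpi (borel_or _ _ _ b3 b1) b2).
        assert (o2 := charge_or _ pi _ _ Cpi b3 b1).
        rewrite (charge_not _ pi S Cpi HS), (proj1 (proj2 (proj1 Hpi))) in o2.
        assert (e1 := proj1 (proj2 Hpi) (fun x => c x = I) (proj2 Hc I)).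
        assert (e2 := proj2 (proj2 Hpi) (fun y => c' y = J) (proj2 Hc' J)).
        cbv beta in *; lra.
Qed.

End Transfer.

(** * Limits along an ultrafilter *)

Definition ultrafilter (U : (nat -> Prop) -> Prop) : Prop :=
  (forall A B : nat -> Prop, (forall k, A k -> B k) -> U A -> U B) /\
  (forall A B, U A -> U B -> U (fun k => A k /\ B k)) /\
  (forall A, U A \/ U (fun k => ~ A k)) /\
  (forall A, U A -> exists k, A k) /\
  (forall N, U (fun k => (N <= k)%nat)).

Section Ultralimit.
Context {U : (nat -> Prop) -> Prop}.
Hypothesis HU : ultrafilter U.

Definition ulim (x : nat -> R) (l : R) : Prop := forall e, 0 < e -> U (fun k => Rabs (x k - l) < e).

Lemma ultrafilter_True : U (fun _ => True).
Proof. destruct HU as [mono [_ [_ [_ tail]]]]; apply mono with (2 := tail O); trivial. Qed.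

Lemma ultrafilter_forall_le (A : nat -> nat -> Prop) n :
  (forall i, (i <= n)%nat -> U (A i)) -> U (fun k => forall i, (i <= n)%nat -> A i k).
Proof.
  destruct HU as [mono [inter _]]; intros H; induction n as [|n IH].
  - apply mono with (2 := H O (le_n _)); intros k Hk i Hi; replace i with O by lia; exact Hk.
  - apply mono with (A := fun k => (forall i, (i <= n)%nat -> A i k) /\ A (S n) k).
    + intros k [H1 H2] i Hi; destruct (Nat.eq_dec i (S n)) as [->|]; [exact H2|apply H1; lia].
    + apply inter; [apply IH; intros; apply H; lia|apply H, le_n].
Qed.

(** The limit is the supremum of the levels [t] with [t <= x k] on a set of [U]. Maximality of [U]
    gives the upper estimate: otherwise [l + e] would itself be such a level. *)
Lemma ulim_exists x M : (forall k, 0 <= x k <= M) -> exists l, ulim x l.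
Proof.
  intros Hx; destruct HU as [mono [inter [ultra [ex _]]]].
  destruct (completeness (fun t => U (fun k => t <= x k))) as [l [Hub Hlub]].
  - exists M; intros t Ht; destruct (ex _ Ht) as [k Hk]; specialize (Hx k); lra.
  - exists 0; apply mono with (2 := ultrafilter_True); intros k _; apply Hx.
  - exists l; intros e He.
    assert (H1 : U (fun k => l - e < x k)).
    { apply NNPP; intros Hn.
      assert (l <= l - e); [|lra]; apply Hlub; intros t Ht.
      apply Rnot_lt_le; intros Hlt; apply Hn; apply mono with (2 := Ht); intros k Hk; lra. }
    assert (H2 : U (fun k => ~ l + e <= x k)).
    { destruct (ultra (fun k => l + e <= x k)) as [h|h]; [|exact h].
      specialize (Hub _ h); lra. }
    apply mono with (2 := inter _ _ H1 H2); intros k [h1 h2]; apply Rabs_def1; lra.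
Qed.

Lemma ulim_le x y l l' : (forall k, x k <= y k) -> ulim x l -> ulim y l' -> l <= l'.
Proof.
  intros H Hl Hl'; destruct HU as [mono [inter [_ [ex _]]]].
  apply Rnot_lt_le; intros Hlt.
  destruct (ex _ (inter _ _ (Hl ((l - l') / 2) ltac:(lra)) (Hl' ((l - l') / 2) ltac:(lra)))) as [k [h1 h2]].
  specialize (H k); apply Rabs_def2 in h1; apply Rabs_def2 in h2; lra.
Qed.

Lemma ulim_unique x l l' : ulim x l -> ulim x l' -> l = l'.
Proof. intros H H'; apply Rle_antisym; apply (ulim_le x x); trivial; intros; lra. Qed.

Lemma ulim_const c : ulim (fun _ => c) c.
Proof.
  intros e He; destruct HU as [mono _]; apply mono with (2 := ultrafilter_True); intros _ _.
  rewrite Rminus_diag, Rabs_R0; exact He.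
Qed.

Lemma ulim_plus x y l l' : ulim x l -> ulim y l' -> ulim (fun k => x k + y k) (l + l').
Proof.
  intros H H' e He; destruct HU as [mono [inter _]].
  apply mono with (2 := inter _ _ (H (e / 2) ltac:(lra)) (H' (e / 2) ltac:(lra))).
  intros k [h1 h2]; apply Rabs_def2 in h1; apply Rabs_def2 in h2; apply Rabs_def1; lra.
Qed.

Lemma ulim_scal c x l : ulim x l -> ulim (fun k => c * x k) (c * l).
Proof.
  intros H e He; destruct HU as [mono _].
  assert (Hc := Rabs_pos c).
  apply mono with (2 := H (e / (Rabs c + 1)) ltac:(apply Rdiv_lt_0_compat; lra)).
  intros k Hk; rewrite <- Rmult_minus_distr_l, Rabs_mult.
  apply (Rmult_lt_compat_l (Rabs c + 1)) in Hk; [|lra].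
  replace ((Rabs c + 1) * (e / (Rabs c + 1))) with e in Hk by (field; lra).
  assert (h := Rabs_pos (x k - l)); nra.
Qed.

Lemma ulim_fsum N (x : nat -> nat -> R) (l : nat -> R) m :
  (forall n, in_range N n -> ulim (fun k => x k n) (l n)) ->
  ulim (fun k => fsum (mask N (x k)) m) (fsum (mask N l) m).
Proof.
  intros H; induction m as [|m IH]; cbn [fsum]; [apply ulim_const|].
  apply ulim_plus; [exact IH|]; unfold mask.
  destruct excluded_middle_informative; [apply H; assumption|apply ulim_const].
Qed.

End Ultralimit.

(* Domination by [mm_mu] makes the setwise ultrafilter limits countably additive,
   without any compactness of the space of measures. *)
Lemma ultralimit_decomposition (X : mmspace) N a U (eta : nat -> nat -> (X -> Prop) -> R) :
  ultrafilter U -> in_A1 N a ->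
  (forall k n, in_range N n -> charge (@mm_d X) (eta k n) /\ eta k n (fun _ => True) = 1) ->
  (forall k B, Borel B -> sum_is N (fun n => a n * eta k n B) (mm_mu B)) ->
  exists la : nat -> (X -> Prop) -> R,
    (forall n, in_range N n -> is_borel_prob (@mm_d X) (la n)) /\
    (forall n B, in_range N n -> Borel B -> @ulim U (fun k => eta k n B) (la n B)) /\
    (forall B, Borel B -> sum_is N (fun n => a n * la n B) (mm_mu B)).
Proof.
  intros HU [Ha Hsa] Heta Hs.
  assert (bnd : forall k n B, in_range N n -> Borel B -> 0 <= eta k n B <= 1).
  { intros k n B Hn HB; destruct (Heta k n Hn) as [C T]; split; [apply C, HB|].
    rewrite <- T; apply (charge_mono mm_d); trivial; apply borel_True. }
  assert (Hex : forall nB : nat * (X -> Prop), exists l,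
    in_range N (fst nB) -> Borel (snd nB) -> @ulim U (fun k => eta k (fst nB) (snd nB)) l).
  { intros [n B]; cbn [fst snd].
    destruct (classic (in_range N n /\ Borel B)) as [[Hn HB]|h]; [|exists 0; tauto].
    destruct (ulim_exists HU (fun k => eta k n B) 1) as [l Hl]; [intros; apply bnd; trivial|].
    exists l; auto. }
  destruct (choice_fun _ Hex) as [l0 Hl0].
  pose (la n B := l0 (n, B)).
  assert (Hla : forall n B, in_range N n -> Borel B -> @ulim U (fun k => eta k n B) (la n B)).
  { intros n B; apply (Hl0 (n, B)). }
  assert (la0 : forall n B, in_range N n -> Borel B -> 0 <= la n B <= 1).
  { intros n B Hn HB; split.
    - apply (ulim_le HU (fun _ => 0) (fun k => eta k n B)); auto using ulim_const; intros; apply bnd; trivial.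
    - apply (ulim_le HU (fun k => eta k n B) (fun _ => 1)); auto using ulim_const; intros; apply bnd; trivial. }
  exists la; split; [|split; [exact Hla|]].
  - intros n Hn; apply is_borel_probE; split.
    + apply charge_dominated.
      * split; [intros B HB; apply la0; trivial|]; intros A B HA HB Hd.
        apply (ulim_unique HU (fun k => eta k n (fun x => A x \/ B x))).
        -- apply Hla; [exact Hn|apply borel_or; assumption].
        -- replace (fun k => eta k n (fun x => A x \/ B x)) with (fun k => eta k n A + eta k n B).
           ++ apply ulim_plus; auto.
           ++ apply functional_extensionality; intros k; symmetry.
              apply (proj1 (Heta k n Hn)); assumption.
      (* The constant comes from [a n * eta k n B <= mm_mu B], which is uniform in [k] and so
         survives in the limit. *)
      * intros e He; exists mm_mu, (/ a n); assert (Han := Ha n Hn).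
        assert (0 < / a n) by (apply Rinv_0_lt_compat; lra).
        split; [apply mm_finmeas|split; [lra|]]; intros B HB.
        enough (la n B <= / a n * mm_mu B) by lra.
        apply (ulim_le HU (fun k => eta k n B) (fun _ => / a n * mm_mu B)); auto using ulim_const.
        intros k; apply Rmult_le_reg_l with (a n); [lra|].
        rewrite <- Rmult_assoc, Rinv_r, Rmult_1_l by lra.
        apply (sum_is_term N (fun n => a n * eta k n B)); [|apply Hs, HB|exact Hn].
        intros i Hi; apply Rmult_le_pos; [specialize (Ha i Hi); lra|apply bnd; trivial].
    + apply (ulim_unique HU (fun k => eta k n (fun _ => True))); [apply Hla; [exact Hn|apply borel_True]|].
      replace (fun k => eta k n (fun _ => True)) with (fun _ : nat => 1); [apply ulim_const, HU|].
      apply functional_extensionality; intros k; symmetry; apply Heta, Hn.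
  - intros B HB; rewrite sum_isP; intros e He.
    (* Series and ultrafilter limit are interchanged: the tail beyond [M] is at most [e / 2] for all
       [k] simultaneously. *)
    destruct (sum_is_uniform_tail N a 1) with (e := e / 2) as [M HM]; trivial; [|lra|].
    { intros n Hn; specialize (Ha n Hn); lra. }
    exists M; intros m Hm.
    assert (L : @ulim U (fun k => fsum (mask N (fun n => a n * eta k n B)) m)
      (fsum (mask N (fun n => a n * la n B)) m)).
    { apply (ulim_fsum HU N (fun k n => a n * eta k n B)); intros n Hn.
      apply ulim_scal; auto. }
    assert (B0 : forall k n, in_range N n -> 0 <= a n * eta k n B <= a n).
    { intros k n Hn; specialize (Ha n Hn); specialize (bnd k n B Hn HB); nra. }
    assert (h1 : fsum (mask N (fun n => a n * la n B)) m <= mm_mu B).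
    { apply (ulim_le HU _ (fun _ => mm_mu B)) with (2 := L); [|apply ulim_const, HU].
      intros k; apply sum_is_partial; [intros n Hn; apply B0, Hn|apply Hs, HB]. }
    assert (h2 : mm_mu B - e / 2 <= fsum (mask N (fun n => a n * la n B)) m).
    { apply (ulim_le HU (fun _ => mm_mu B - e / 2)) with (3 := L); [|apply ulim_const, HU].
      intros k; assert (h := HM _ _ (B0 k) (Hs k B HB) m Hm); lra. }
    unfold Rdist; apply Rabs_def1; lra.
Qed.

(** * Box-closedness *)

(** The measure [la], the partition [c] and the accuracy [eps] stay quantified inside, because they
    are chosen after the whole sequence of approximations. The bound [3 * e] is the distortion of
    [S] plus twice the cell diameter on [Y]; [2 * e] is the mass missed by [S] plus the remainder
    cell of [Y]. *)
Lemma splits_approximation N a P (X Y : mmspace) e : in_A1 N a -> 0 < e ->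
  splits N a P Y -> box_lt X Y e ->
  exists eta : nat -> (X -> Prop) -> R,
    (forall n, in_range N n -> charge (@mm_d X) (eta n) /\ eta n (fun _ => True) = 1) /\
    (forall B, Borel B -> sum_is N (fun n => a n * eta n B) (mm_mu B)) /\
    (forall n, in_range N n -> exists Z, P n Z /\
       forall la h c I dl eps, labelling (@mm_d X) c I ->
         (forall x y, c x = c y -> (c x < I)%nat -> mm_d x y <= dl) ->
         3 * e + 2 * dl < eps ->
         / a n * (2 * e + mm_mu (fun x => c x = I)) +
           sum_f_R0 (fun i => Rabs (eta n (fun x => c x = i) - la (fun x => c x = i))) I < eps ->
         box_lt (with_measure X la h) Z eps).
Proof.
  intros HA He [nu [HP Hs]] [pi [S [e' [Hpi [HS [He' [Hdis HpS]]]]]]].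
  destruct (small_labelling Y e e He He) as [c' [J [Hc' [Hdl' Hrest]]]].
  assert (Hpr : forall n, in_range N n -> is_borel_prob (@mm_d Y) (nu n)).
  { intros n Hn; destruct (HP n Hn) as [h _]; exact h. }
  assert (Hdom : forall n B, in_range N n -> Borel B -> a n * nu n B <= mm_mu B).
  { intros n B; apply (summand_dominated N a Y mm_d nu mm_mu n B HA Hpr Hs). }
  assert (Hpos : forall n, in_range N n -> 0 < a n).
  { intros n Hn; destruct HA as [Ha _]; specialize (Ha n Hn); lra. }
  exists (fun n => transfer pi c' J (nu n)); split; [|split].
  - intros n Hn; specialize (Hpr n Hn); specialize (Hpos n Hn).
    split; [apply (transfer_charge Hpi Hc' Hpr Hpos)|apply (transfer_True Hpi Hc' Hpr Hpos)];
      intros B; apply Hdom, Hn.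
  - apply (transfer_sum Hpi Hc' N a nu HA Hpr Hs).
  - intros n Hn; destruct (HP n Hn) as [hn Hh]; exists (with_measure Y (nu n) hn).
    split; [exact Hh|]; intros la h c I dl eps Hc Hdl E1 E2.
    apply (transfer_box Hpi Hc' hn (Hpos n Hn) (fun B => Hdom n B Hn) S c I e dl e la h eps); trivial.
    + intros p q Hp Hq; specialize (Hdis p q Hp Hq); lra.
    + lra.
    + lra.
    + assert (0 < / a n) by (apply Rinv_0_lt_compat, Hpos, Hn).
      eapply Rle_lt_trans; [|exact E2]; apply Rplus_le_compat_r, Rmult_le_compat_l; lra.
Qed.

Lemma splits_box_closed N a P : in_A1 N a ->
  (forall n, in_range N n -> box_closed (P n)) -> box_closed (splits N a P).
Proof.
  intros HA Hcl X HX.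
  destruct MathCompBridge.nonprincipal_ultrafilter as [U HU].
  change (ultrafilter U) in HU.
  (* The k-th approximation has accuracy [/ INR (S k)]; its space [Y] is reached again later through
     [Z]. *)
  assert (Hk := fun k => let '(ex_intro Y (conj HY Hb)) := HX _ (inv_INR_pos k) in
    splits_approximation N a P X Y _ HA (inv_INR_pos k) HY Hb).
  apply choice_fun in Hk; destruct Hk as [eta Heta].
  destruct (ultralimit_decomposition X N a U eta HU HA) as [la [Hla [Hlim Hsum]]].
  { intros k; apply (Heta k). }
  { intros k; apply (Heta k). }
  exists la; split; [|exact Hsum].
  intros n Hn; exists (Hla n Hn); apply (Hcl n Hn); intros eps Heps.
  assert (Han : 0 < a n) by (apply HA, Hn).
  assert (Hinv : 0 < / a n) by apply Rinv_0_lt_compat, Han.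
  (* The factor [a n] cancels the later [/ a n]. In eighths of [eps], the distortion is at most 3 +
     2 and the lost mass at most 1 + 2 + 2, from [2 * e], the remainder cell and the cell errors. *)
  destruct (small_labelling X (eps / 8) (a n * (eps / 4))) as [c [I [Hc [Hdl Hrest]]]];
    [lra|apply Rmult_lt_0_compat; lra|].
  (* The [I + 1] labels share a total error of [eps / 4]. *)
  pose (t := eps / (4 * INR (S I))).
  assert (HI : 0 < INR (S I)) by (apply lt_0_INR; lia).
  assert (Ht : 0 < t) by (apply Rdiv_lt_0_compat; lra).
  destruct (small_inv (Rmin (eps / 8) (a n * (eps / 16)))) as [k0 Hk0].
  { apply Rmin_glb_lt; [lra|apply Rmult_lt_0_compat; lra]. }
  destruct HU as [mono [inter [ultra [ex tail]]]].
  assert (Hcells := ultrafilter_forall_le (conj mono (conj inter (conj ultra (conj ex tail))))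
    (fun i k => Rabs (eta k n (fun x => c x = i) - la n (fun x => c x = i)) < t) I
    (fun i _ => Hlim n _ Hn (proj2 Hc i) t Ht)).
  destruct (ex _ (inter _ _ (tail k0) Hcells)) as [k [Hkk Hclose]].
  assert (He : / INR (S k) <= / INR (S k0)).
  { apply Rinv_le_contravar; [apply lt_0_INR; lia|apply le_INR; lia]. }
  assert (m1 := Rmin_l (eps / 8) (a n * (eps / 16))).
  assert (m2 := Rmin_r (eps / 8) (a n * (eps / 16))).
  destruct (Heta k) as [_ [_ Hap]]; destruct (Hap n Hn) as [Z [HZ Hbox]].
  exists Z; split; [exact HZ|]; apply (Hbox _ _ c I (eps / 8)); trivial; [lra|].
  assert (s1 : sum_f_R0 (fun i => Rabs (eta k n (fun x => c x = i) - la n (fun x => c x = i))) I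
    <= eps / 4).
  { apply Rle_trans with (sum_f_R0 (fun _ => t) I).
    - apply sum_Rle; intros i Hi; left; apply Hclose, Hi.
    - rewrite sum_cte; unfold t; right; field; lra. }
  assert (s2 : / a n * (2 * / INR (S k) + mm_mu (fun x => c x = I)) <= / a n * (a n * (eps * (3 / 8)))).
  { apply Rmult_le_compat_l; lra. }
  rewrite <- Rmult_assoc, Rinv_l, Rmult_1_l in s2 by lra; lra.
Qed.

(** * The pyramid axioms for direct sums *)

Theorem theorem1p1 :
  forall (N : option nat) (a : nat -> R) (P : nat -> mmspace -> Prop),
    in_A1 N a ->
    (forall n, in_range N n -> pyramid (P n)) ->
    pyramid (direct_sum N a P).
Proof.
  intros N a P HA HP.
  assert (Hiso : forall n, in_range N n -> iso_invariant (P n)) by (intros n Hn; apply HP, Hn).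
  assert (Hdown : forall n, in_range N n -> lip_closed (P n)).
  { intros n Hn; exact (proj1 (proj2 (proj2 (proj2 (HP n Hn))))). }
  assert (to_splits : forall X, direct_sum N a P X -> splits N a P X).
  { intros X; apply splits_of_direct_sum; assumption. }
  assert (of_splits : forall X, splits N a P X -> direct_sum N a P X).
  { intros X; apply direct_sum_of_splits, mm_iso_refl. }
  split; [|split; [|split; [|split]]].
  (* [direct_sum] allows an intermediate isomorphic space, so the splitting can stay on [X] while
     the isomorphism is reversed. *)
  - intros X Y HXY HX; apply (direct_sum_of_splits N a P Y X); auto using mm_iso_sym.
  - destruct (splits_nonempty N a P HA Hdown) as [X HX]; [|exists X; auto].
    intros n Hn; apply HP, Hn.
  - intros X HX; apply of_splits, splits_box_closed; trivial; [intros n Hn; apply HP, Hn|].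
    intros e He; destruct (HX e He) as [Y [HY Hb]]; exists Y; auto.
  - intros X Y HY HXY; apply of_splits, (splits_lip_closed N a P Hdown X Y); auto.
  - intros X Y HX HY.
    destruct (splits_directed N a P HA Hdown) with (X := X) (Y := Y) as [Z [HZ HZ']]; auto.
    + intros n Hn; exact (proj2 (proj2 (proj2 (proj2 (HP n Hn))))).
    + exists Z; auto.
Qed.
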